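(* Let $d\ge2$ be a fixed integer and let $(G_n)$ be a sequence of finite abelian groups of odd orders $N_n\to\infty$. For every fixed $c\in\mathbb R$, $$d_{\mathrm{TV}}\bigl(\mathcal L(V_n(c)),\operatorname{Poisson}(e^{-c})\bigr)\longrightarrow 0\qquad(n\to\infty).$$ Moreover, $$\mathbb P\bigl(\operatorname{diam}\Gamma_{G_n}^*(r_n(c))\le d\bigr)\longrightarrow \exp\{-e^{-c}\}.$$ If $W_n(c)$ denotes the number of nonzero vertices of $\Gamma_{G_n}^*(r_n(c))$ at distance greater than $d$ from $0$, then $W_n(c)=2V_n(c)$ identically.
   Context: For a finite abelian group $G$ (written additively) of odd order $N$, let $\mathcal Q_G=(G\setminus\{0\})/\{\pm1\}$ be the set of inversion classes $[a]=\{a,-a\}$; each has two elements and $|\mathcal Q_G|=M=(N-1)/2$. Let $(T_\xi)_{\xi\in\mathcal Q_G}$ be independent random variables uniform on $[0,1]$. The class $\xi$ is active at time $r$ if $T_\xi\le r$, and $\Gamma_G^*(r)$ is the undirected Cayley graph on $G$ whose connection set is the union of all classes active at time $r$. Distances and the diameter are graph distances (infinite if disconnected). Put $$r_N(c)=\left(\frac{d!(\log M+c)}{N^{d-1}}\right)^{1/d},\qquad M=\frac{N-1}{2},$$ whenever the expression is positive (which holds for all large $N$, for fixed $c$), and $r_n(c)=r_{N_n}(c)$. Define $$V_n(c)=\#\bigl\{[x]\in\mathcal Q_{G_n}:\operatorname{dist}_{\Gamma_{G_n}^*(r_n(c))}(0,x)>d\bigr\}.$$ $\mathcal L(V)$ denotes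 the law of $V$ and $d_{\mathrm{TV}}$ the total variation distance. *)

(* Defs.v *)
From HB Require Import structures.
From mathcomp Require Import all_boot all_order all_algebra.
From mathcomp Require Import all_classical all_reals all_analysis.

Set Implicit Arguments.
Unset Strict Implicit.
Unset Printing Implicit Defensive.

Import Order.TTheory GRing.Theory Num.Theory.
Import numFieldNormedType.Exports.

Local Open Scope classical_set_scope.
Local Open Scope ring_scope.

Section GraphDistance.
Context (R : realType) (V : Type) (e : rel V).

(* The infimum of the lengths of the e-walks from x to y; it is +oo when
   there is no such walk. *)
Definition gdist (x y : V) : \bar R :=
  ereal_inf [set (size p)%:R%:E | p in [set p | path e x p /\ last x p = y]].

Definition diameter : \bar R := ereal_sup [set gdist xy.1 xy.2 | xy in setT].

End GraphDistance.

Section InversionClasses.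
Context (G : finZmodType).

Definition inv_class (a : G) : {set G} := [set a; - a]%SET.

Definition inv_classes : {set {set G}} :=
  [set inv_class a | a in [set~ 0]]%SET.

Definition inversion_class : finType := {xi : {set G} | xi \in inv_classes}.

(* This relation is symmetric when S is closed under negation, as is any union
   of inversion classes. *)
Definition cayley (S : {set G}) : rel G := fun x y => y - x \in S.

End InversionClasses.

Section Probability.
Context (R : realType) (disp : measure_display) (Omega : measurableType disp)
  (P : probability Omega R).

Definition mutually_independent (I : finType) (X : I -> {RV P >-> R}) :=
  forall (J : {set I}) (A : I -> set R),
    (forall i, i \in J -> measurable (A i)) ->
    P (\bigcap_(i in [set` J]) X i @^-1` A i) =
    (\prod_(i in J) P (X i @^-1` A i))%E.

Definition uniform01 (X : {RV P >-> R}) :=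
  forall A : set R, measurable A ->
    distribution P X A = uniform_prob (@ltr01 R) A.

Definition dTV (mu nu : probability Omega R) : \bar R :=
  ereal_sup [set `|mu A - nu A|%E | A in [set A | measurable A]].

End Probability.

Section RandomCayleyGraph.
Context (R : realType) (disp : measure_display) (Omega : measurableType disp)
  (P : probability Omega R) (G : finZmodType)
  (T : inversion_class G -> {RV P >-> R}).

Definition active (r : R) (w : Omega) : {set inversion_class G} :=
  [set xi | T xi w <= r]%SET.

Definition connection_set (A : {set inversion_class G}) : {set G} :=
  (\bigcup_(xi in A) val xi)%SET.

Definition Gamma (r : R) (w : Omega) : rel G :=
  cayley (connection_set (active r w)).

Definition far_vertices (d : nat) (e : rel G) : {set G} :=
  [set x : G | (x != 0) && (d%:R%:E < gdist R e 0%R x)%E]%SET.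

(* the number W of far vertices and the number V of their inversion classes *)
Definition far_vertex_count (d : nat) (r : R) (w : Omega) : nat :=
  #|far_vertices d (Gamma r w)|.

Definition far_class_count (d : nat) (r : R) (w : Omega) : nat :=
  #|[set inv_class x | x in far_vertices d (Gamma r w)]%SET|.

Lemma measurable_active_fun (F : {set inversion_class G} -> nat) (r : R) :
  measurable_fun setT (fun w => F (active r w)).
Proof.
move=> _ Y _; rewrite setTI.
have -> : (fun w => F (active r w)) @^-1` Y =
    \bigcup_(S in [set S | Y (F S)])
      \bigcap_(xi in [set: inversion_class G])
        [set w | (T xi w <= r) = (xi \in S)].
  apply/seteqP; split => w /=.
    by move=> YF; exists (active r w) => //= xi _; rewrite /active inE.
  move=> [S /= YS wS]; suff -> : active r w = S by [].
  by apply/setP => xi; rewrite inE; exact: wS.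
apply: fin_bigcup_measurable => [|S _]; first exact: finite_finset.
apply: fin_bigcap_measurable => [|xi _]; first exact: finite_finset.
have mT : measurable [set w | T xi w <= r].
  have -> : [set w | T xi w <= r] = T xi @^-1` `]-oo, r].
    by apply/seteqP; split => w /=; rewrite in_itv.
  by rewrite -[X in measurable X]setTI; exact: measurable_funPT.
case: (xi \in S) => //.
have -> : [set w | (T xi w <= r) = false] = ~` [set w | T xi w <= r].
  by apply/seteqP; split => w /= => [->//|/negP/negbTE].
exact: measurableC.
Qed.

Lemma measurable_far_class_count (d : nat) (r : R) :
  measurable_fun setT (far_class_count d r).
Proof.
exact: (measurable_active_fun (fun A =>
  #|[set inv_class x | x in far_vertices d (cayley (connection_set A))]%SET|)).
Qed.

HB.instance Definition _ (d : nat) (r : R) :=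
  isMeasurableFun.Build _ _ _ _ (far_class_count d r)
    (measurable_far_class_count d r).

End RandomCayleyGraph.

(* The second argument of poisson_prob is a dummy. *)
Definition Poisson (R : realType) (rate : R) : probability nat R :=
  poisson_prob rate 0%N.

(* powR is total: the value is meaningful only when its base is positive,
   which, for fixed d and c, holds for all large N. *)
Definition threshold (R : realType) (d N : nat) (c : R) : R :=
  let M : R := (N%:R - 1) / 2 in
  (d`!%:R * (ln M + c) / N%:R ^+ d.-1) `^ d%:R^-1.

(* Main.v *)
Require Import Defs.
From HB Require Import structures.
From mathcomp Require Import all_boot all_order all_fingroup all_algebra.
From mathcomp Require Import all_classical all_reals all_analysis.
From mathcomp Require Import zify ring lra.

Set Implicit Arguments.
Unset Strict Implicit.
Unset Printing Implicit Defensive.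

Import Order.TTheory GRing.Theory Num.Theory.
Import numFieldNormedType.Exports.

Local Open Scope ring_scope.

(** Write [N] for the order of the group, [M = (N - 1) / 2] for the number of
    inversion classes, [p] for the threshold and [L = ln M + c], so that
    [N ^ (d - 1) * p ^ d / d! = L] and [exp (- L) = exp (- c) / M]. The active
    classes form a random set in which every class is present with probability
    [p], independently ([prob_active]), so everything takes place under a
    product measure on a finite set. (All this is for large [N], when [L] is
    positive and [p] is at most [1].)

    An element [x] is within distance [d] of [0] if and only if it is a sum of
    [d] terms, each of which is [0] or belongs to an active class ([farE]).
    Usually the [d] terms belong to [d] distinct classes. Up to a relative
    error [O(1 / N)], there are [N ^ (d - 1) / d!] sets of [d] classes which
    represent [x] in this way. For [k] elements from [k] different inversion
    classes, the families of representing sets are essentially disjoint: as the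
    order of the group is odd, a set of classes can represent two of the
    elements, or one of them twice, only if some proper partial sum takes one
    of boundedly many values ([generic_fiber], [card_rep_family_ge]). The
    expected number of active representing sets is therefore close to [k * L],
    while pairs of overlapping sets are too rare to matter ([overlap_le]).
    Janson's inequality bounds the probability that all [k] elements are far by
    [exp (- k * L)] up to a factor tending to [1] ([far_upper]), and Harris'
    inequality gives the matching lower bound ([far_lower]).

    Sums whose terms meet fewer than [d] classes need a separate argument,
    because torsion can give a particular element very many of them. However,
    the expected number of elements reached by such sums is
    [O((N * p) ^ (d - 1)) = o(N)] ([sum_short_prob]), which is enough after
    averaging over all the choices of [k] classes.

    Summing over the [M choose k] choices shows that the binomial moments of
    the number [V] of far classes tend to [exp (- c) ^ k / k!], which are those
    of the Poisson law ([cvg_moment]). Bonferroni's inequalities turn this into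
    the convergence of the probabilities of [V = j] ([cvg_pmf]), and Scheffe's
    argument into convergence in total variation ([scheffe]). A Cayley graph
    looks the same from all its vertices, so its diameter is at most [d] if and
    only if [V = 0], and this has limiting probability [exp (- exp (- c))].
    Finally, an odd order leaves no [x <> 0] equal to its opposite, and so far
    vertices come in pairs [x], [- x]. *)

(** * The Harris and Janson inequalities for a random set *)

Section BernoulliSubset.
Import mathcomp.boot.fintype mathcomp.boot.finset.
Context (R : realType) (Q : finType) (p : R).
Implicit Types (S A B : {set Q}) (f g : {set Q} -> R).

Definition weight S : R := \prod_(i : Q) (if i \in S then p else 1 - p).

Definition expect f : R := \sum_(S : {set Q}) weight S * f S.

Lemma eq_expect f g : f =1 g -> expect f = expect g.
Proof. by move=> fg; apply: eq_bigr => S _; rewrite fg. Qed.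

Lemma expect_cst (a : R) : expect (fun=> a) = a.
Proof.
rewrite /expect -mulr_suml -[RHS]mul1r; congr (_ * _).
rewrite -(@bigA_distr _ _ _ _ _ _ (fun=> p) (fun=> 1 - p)) big1 // => i _.
by rewrite /= subrKC.
Qed.

Lemma expectD f g : expect (fun S => f S + g S) = expect f + expect g.
Proof. by rewrite /expect -big_split; apply: eq_bigr => S _; rewrite mulrDr. Qed.

Lemma expectZ (a : R) f : expect (fun S => a * f S) = a * expect f.
Proof. by rewrite /expect mulr_sumr; apply: eq_bigr => S _; rewrite mulrCA. Qed.

Lemma expectB f g : expect (fun S => f S - g S) = expect f - expect g.
Proof.
rewrite -[in RHS]mulN1r -expectZ -expectD.
by apply: eq_expect => S; rewrite mulN1r.
Qed.

Lemma expect_sum (I : Type) (s : seq I) (P : pred I) (F : I -> {set Q} -> R) :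
  expect (fun S => \sum_(i <- s | P i) F i S) = \sum_(i <- s | P i) expect (F i).
Proof.
rewrite /expect exchange_big /=; apply: eq_bigr => S _.
by rewrite mulr_sumr.
Qed.

(** Averaging over coordinate [i] alone. Iterating it over all coordinates
    reduces statements on [expect] to statements on one biased coin. *)
Definition resample (i : Q) f S := p * f (i |: S)%SET + (1 - p) * f (S :\ i)%SET.

Lemma expect_split i f : expect f =
  \sum_(S : {set Q} | i \notin S) (\prod_(j | j != i) if j \in S then p else 1 - p)
    * (p * f (i |: S)%SET + (1 - p) * f S).
Proof.
have wE S : weight S = (if i \in S then p else 1 - p) *
    \prod_(j | j != i) (if j \in S then p else 1 - p).
  by rewrite /weight (bigD1 i).
rewrite /expect (bigID (fun S => i \in S)) /=.
rewrite (reindex_onto (fun S => i |: S)%SET (fun S => S :\ i)%SET) /=; last first.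
  by move=> S iS; rewrite setD1K.
rewrite (eq_bigl (fun S => i \notin S)) => [|S]; last first.
  rewrite setU11 /=; apply/eqP/idP => [<-|iS]; first by rewrite setD11.
  by rewrite setU1K.
rewrite -big_split /=; apply: eq_bigr => S iS.
rewrite !wE setU11 (negbTE iS) mulrDr !mulrA ![_ * p]mulrC ![_ * (1 - p)]mulrC.
congr (_ * _ * _ + _); apply: eq_bigr => j ji.
by rewrite in_setU1 (negbTE ji).
Qed.

Lemma expect_resample i f : expect (resample i f) = expect f.
Proof.
rewrite !(expect_split i); apply: eq_bigr => S iS; congr (_ * _).
rewrite /resample setU1K // setUA setUid.
have -> : (S :\ i = S)%SET by apply/setDidPl; rewrite disjoint_sym disjoints1.
by rewrite -mulrDl addrC subrK mul1r.
Qed.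

(** [f] does not depend on the coordinates in [A], phrased with the two sets
    that [resample] compares. *)
Definition ignores (A : {set Q}) f :=
  forall i S, i \in A -> f (i |: S)%SET = f (S :\ i)%SET.

Lemma expect_mem1 i f : ignores [set i]%SET f ->
  expect (fun S => (i \in S)%:R * f S) = p * expect f.
Proof.
move=> fi; rewrite -(expect_resample i) -[in RHS](expect_resample i) -expectZ.
apply: eq_expect => S; rewrite /resample fi ?set11//.
by rewrite setU11 setD11 mul1r mul0r mulr0 addr0 -mulrDl (addrC p) subrK mul1r.
Qed.

(** The elements of [B] are removed one at a time: given all the other
    coordinates, each is an independent coin. *)
Lemma expect_subset_mul B f : ignores B f ->
  expect (fun S => (B \subset S)%:R * f S) = p ^+ #|B| * expect f.
Proof.
elim: {B}#|B| {-2}B (erefl #|B|) => [|n IH] B cB fB.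
  rewrite cB expr0 mul1r; apply: eq_expect => S.
  by move/eqP: cB; rewrite cards_eq0 => /eqP ->; rewrite sub0set mul1r.
have /card_gt0P[i iB] : (0 < #|B|)%N by rewrite cB.
have cB' : #|B :\ i|%SET = n by move: (cardsD1 i B); rewrite iB cB => -[].
rewrite cB exprS -mulrA -cB' -IH ?cB' //; last first.
  by move=> j S; rewrite !inE => /andP[_]; exact: fB.
rewrite -(@expect_mem1 i); last first.
  move=> j S; rewrite inE => /eqP ->; rewrite fB //; congr (_%:R * _); congr nat_of_bool.
  apply/subsetP/subsetP => H k kB; move: (H k kB); move: kB;
    by rewrite !inE => /andP[/negbTE ->].
apply: eq_expect => S; rewrite mulrA -natrM mulnb; congr (_%:R * _); congr nat_of_bool.
by rewrite -[in LHS](setD1K iB) subUset sub1set.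
Qed.

Lemma expect_subset B : expect (fun S => (B \subset S)%:R) = p ^+ #|B|.
Proof.
rewrite -[RHS]mulr1 -[in RHS](expect_cst 1) -expect_subset_mul //.
by apply: eq_expect => S; rewrite mulr1.
Qed.

Context (p_ge0 : 0 <= p) (p_le1 : p <= 1).

Let q_ge0 : 0 <= 1 - p. Proof. by rewrite subr_ge0. Qed.

Lemma weight_ge0 S : 0 <= weight S.
Proof. by apply: prodr_ge0 => i _; case: ifP. Qed.

Lemma le_expect f g : (forall S, f S <= g S) -> expect f <= expect g.
Proof. by move=> fg; apply: ler_sum => S _; rewrite ler_wpM2l ?weight_ge0. Qed.

Lemma expect_ge0 f : (forall S, 0 <= f S) -> 0 <= expect f.
Proof. by move=> f0; rewrite -(expect_cst 0); exact: le_expect. Qed.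

Definition decreasing f := forall A B, A \subset B -> f B <= f A.

Lemma decreasing_resample i f : decreasing f -> decreasing (resample i f).
Proof.
move=> fd A B AB; rewrite /resample lerD // ler_wpM2l //; apply: fd.
  by rewrite setUS.
by rewrite setSD.
Qed.

(** On one coin, two decreasing functions are positively correlated, because
    [(f0 - f1) * (g0 - g1)] is nonnegative; resampling a coin keeps functions
    decreasing, so that this can be iterated. *)
Lemma resample_iter_correlation l f g S : decreasing f -> decreasing g ->
  foldr resample f l S * foldr resample g l S
    <= foldr resample (fun S => f S * g S) l S.
Proof.
move=> fd gd.
have itd h : decreasing h -> forall l, decreasing (foldr resample h l).
  by move=> hd; elim=> //= i k; exact: decreasing_resample.
elim: l S => [|i l IH] S //=; rewrite {1 2}/resample.
have SS : (S :\ i \subset i |: S)%SET.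
  by apply: (subset_trans (subD1set _ _)); exact: subsetUr.
have := itd _ fd l _ _ SS; have := itd _ gd l _ _ SS.
set f1 := foldr resample f l _; set f0 := foldr resample f l _.
set g1 := foldr resample g l _; set g0 := foldr resample g l _ => gg ff.
apply: (@le_trans _ _ (p * (f1 * g1) + (1 - p) * (f0 * g0))); last first.
  by rewrite /resample lerD // ler_wpM2l // IH.
rewrite -subr_ge0.
have -> : p * (f1 * g1) + (1 - p) * (f0 * g0) -
  (p * f1 + (1 - p) * f0) * (p * g1 + (1 - p) * g0) =
  p * (1 - p) * ((f0 - f1) * (g0 - g1)) by ring.
by rewrite !mulr_ge0 // subr_ge0.
Qed.

(** Resampling the coordinates in [l] erases the dependence on [l]. *)
Lemma expect_iter f S : expect f = foldr resample f (enum Q) S.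
Proof.
have iterE l (T : {set Q}) : (forall j, j \notin l -> (j \in S) = (j \in T)) ->
    foldr resample f l S = foldr resample f l T.
  elim: l S T => [|i l IH] A B AB /=.
    by congr f; apply/setP => j; exact: AB.
  by congr (_ * _ + _ * _); apply: IH => j jl; rewrite !inE;
    have [//|ji] := eqVneq j i; rewrite AB // inE negb_or ji.
rewrite -[RHS]expect_cst; transitivity (expect (foldr resample f (enum Q))).
  by elim: (enum Q) => //= i l IH; rewrite expect_resample.
by apply: eq_expect => T; apply/esym/iterE => j; rewrite mem_enum.
Qed.

(** Harris' inequality: once all the coordinates have been resampled, a
    function is constant, equal to its expectation. *)
Lemma harris f g : decreasing f -> decreasing g ->
  expect f * expect g <= expect (fun S => f S * g S).
Proof.
move=> fd gd; rewrite !(expect_iter _ set0).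
exact: resample_iter_correlation.
Qed.

(** The indicator of [B \subset S] is increasing, which reverses Harris'
    inequality. *)
Lemma harris_subset B g : decreasing g ->
  expect (fun S => (B \subset S)%:R * g S) <= p ^+ #|B| * expect g.
Proof.
move=> gd; rewrite -expect_subset -subr_ge0.
have h : decreasing (fun S => 1 - (B \subset S)%:R).
  move=> A C AC; rewrite lerD2l lerN2 ler_nat.
  by case: (boolP (B \subset A)) => // BA; rewrite (subset_trans BA AC).
have := harris h gd; rewrite -subr_ge0; congr (0 <= _).
rewrite expectB expect_cst mulrBl mul1r.
rewrite (eq_expect (g := fun S => g S - (B \subset S)%:R * g S)) => [|S].
  by rewrite expectB; ring.
by rewrite mulrBl mul1r.
Qed.

Definition avoids (s : seq {set Q}) S := all (fun B => ~~ (B \subset S)) s.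

Lemma decreasing_avoids s : decreasing (fun S => (avoids s S)%:R).
Proof.
move=> A B AB; rewrite ler_nat; case: (boolP (avoids s B)) => //= /allP sB.
rewrite (_ : avoids s A) //; apply/allP => C /sB.
by apply: contra => CA; exact: subset_trans AB.
Qed.

Lemma expect_avoids_ge0 s : 0 <= expect (fun S => (avoids s S)%:R).
Proof. by apply: expect_ge0 => S; rewrite ler0n. Qed.

(** By Harris' inequality, avoiding the earlier sets only makes it more likely
    to avoid the next one. *)
Lemma expect_avoids_ge (s : seq {set Q}) :
  \prod_(B <- s) (1 - p ^+ #|(B : {set Q})|) <= expect (fun S => (avoids s S)%:R).
Proof.
elim: s => [|B s IH]; first by rewrite big_nil (expect_cst 1).
rewrite big_cons.
have q0 : 0 <= 1 - p ^+ #|B| by rewrite subr_ge0 exprn_ile1.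
apply: le_trans (ler_wpM2l q0 IH) _.
rewrite [leRHS](eq_expect (g := fun S => (avoids s S)%:R - (B \subset S)%:R *
  (avoids s S)%:R)).
  by rewrite expectB mulrBl mul1r lerD2l lerN2 harris_subset //; exact: decreasing_avoids.
by move=> S /=; rewrite -natrM mulnb; case: (B \subset S); case: (avoids s S);
  rewrite /= ?subr0 ?subrr.
Qed.

(** The new set [B] is hit, while [s] is avoided, with probability at least
    [(p ^+ #|B| - Delta)] times that of avoiding [s]: discard the members of
    [s] that meet [B], use independence from the others, and correct for the
    discarded ones by a union bound and Harris' inequality. *)
Lemma expect_avoids_cons_le B s :
  expect (fun S => (avoids (B :: s) S)%:R) <=
  expR (- p ^+ #|B| + \sum_(C <- s | ~~ [disjoint B & C]) p ^+ #|B :|: C|%SET) *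
  expect (fun S => (avoids s S)%:R).
Proof.
set Delta := \sum_(C <- s | _) _.
pose far := [seq C : {set Q} <- s | [disjoint B & C]].
(* Splitting the members of [s] according to whether they meet [B]: those that
   do not are independent of [B], the others are handled by a union bound. *)
have pointwise S : (B \subset S)%:R * (avoids far S)%:R
    - \sum_(C <- s | ~~ [disjoint B & C]) (B :|: C \subset S)%SET%:R * (avoids far S)%:R
    <= (B \subset S)%:R * (avoids s S)%:R :> R.
  have [BS|] := boolP (B \subset S); last first.
    move=> nBS; rewrite !mul0r sub0r oppr_le0 sumr_ge0 // .
  have [fS|nfS] := boolP (avoids far S); last first.
    rewrite mulr0 big1 ?subr0 ?mulr_ge0 // => C _; by rewrite mulr0.
  have [sS|/allPn[C Cs]] := boolP (avoids s S).
    by rewrite !mul1r lerBlDr lerDl sumr_ge0 // => C _; apply: mulr_ge0; rewrite ?ler0n.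
  rewrite negbK => CS; rewrite mulr0 mul1r subr_le0.
  have mBC : ~~ [disjoint B & C].
    apply: contraL CS => dBC; apply: (allP fS).
    by rewrite mem_filter dBC.
  rewrite (big_rem C Cs) /= mBC mulr1 subUset BS CS lerDl.
  by apply: sumr_ge0 => D _; rewrite mulr_ge0.
have far_s : expect (fun S => (avoids s S)%:R) <= expect (fun S => (avoids far S)%:R).
  apply: le_expect => S; rewrite ler_nat; case: (boolP (avoids s S)) => //= /allP sS.
  by rewrite (_ : avoids far S) //; apply/allP => C; rewrite mem_filter => /andP[_ /sS].
have hit : (p ^+ #|B| - Delta) * expect (fun S => (avoids far S)%:R) <=
    expect (fun S => (B \subset S)%:R * (avoids s S)%:R).
  apply: le_trans (le_expect pointwise); rewrite expectB expect_sum.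
  rewrite expect_subset_mul; last first.
    move=> i S iB; congr (_%:R); congr nat_of_bool.
    apply: eq_in_all => C; rewrite mem_filter => /andP[dBC _]; congr negb.
    have iC : i \notin C by apply: contraL dBC => iC; apply/pred0Pn; exists i;
      rewrite /= iB.
    rewrite subsetD1 iC andbT; apply/subsetP/subsetP => H j jC.
      by have := H j jC; rewrite !inE => /orP[/eqP ji|//]; rewrite ji (negbTE iC) in jC.
    by rewrite !inE H ?orbT.
  rewrite mulrBl lerD2l lerN2 /Delta mulr_suml; apply: ler_sum => C _.
  by apply: harris_subset; exact: decreasing_avoids.
have consE : expect (fun S => (avoids (B :: s) S)%:R) =
    expect (fun S => (avoids s S)%:R) - expect
      (fun S => (B \subset S)%:R * (avoids s S)%:R).
  rewrite -expectB; apply: eq_expect => S /=; rewrite -natrM mulnb.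
  by case: (B \subset S); case: (avoids s S); rewrite /= ?subr0 ?subrr.
rewrite consE.
have E0 := expect_avoids_ge0 s.
have hit0 : 0 <= expect (fun S => (B \subset S)%:R * (avoids s S)%:R).
  by apply: expect_ge0 => S; rewrite mulr_ge0.
have [D0|D0] := leP 0 (p ^+ #|B| - Delta).
  apply: (@le_trans _ _ ((1 - (p ^+ #|B| - Delta)) * expect (fun S => (avoids s S)%:R))).
    rewrite mulrBl mul1r lerD2l lerN2; apply: le_trans hit.
    by rewrite ler_wpM2l.
  rewrite ler_wpM2r //; apply: le_trans (expR_ge1Dx _).
  lra.
apply: (@le_trans _ _ (1 * expect (fun S => (avoids s S)%:R))).
  by rewrite mul1r lerBlDr lerDl.
rewrite ler_wpM2r // -expR0 ler_expR; lra.
Qed.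

(** Janson's inequality, by the argument of Boppana and Spencer: the sets are
    added one at a time, and the factors of [expect_avoids_cons_le] multiply. *)
Lemma janson_seq (s : seq {set Q}) : uniq s ->
  expect (fun S => (avoids s S)%:R) <=
  expR (\sum_(B <- s) (- p ^+ #|B| +
    \sum_(C <- s | (C != B) && ~~ [disjoint B & C]) p ^+ #|B :|: C|%SET)).
Proof.
elim: s => [|B s IH] /=; first by rewrite big_nil expR0 (expect_cst 1).
move=> /andP[Bs us]; apply: le_trans (expect_avoids_cons_le _ _) _.
rewrite [in leRHS]big_cons [leRHS]expRD; apply: ler_pM;
  rewrite ?expR_ge0 ?expect_avoids_ge0 //.
  rewrite ler_expR lerD2l big_cons eqxx /= big_seq_cond [leRHS]big_seq_cond.
  rewrite le_eqVlt; apply/orP; left; apply/eqP/eq_bigl => C.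
  have [->|//] := eqVneq C B; first by rewrite (negbTE Bs).
apply: le_trans (IH us) _; rewrite ler_expR; apply: ler_sum => C _.
by rewrite lerD2l big_cons; case: ifP => // _; rewrite lerDr exprn_ge0.
Qed.

Lemma janson (F : {set {set Q}}) :
  expect (fun S => (avoids (enum F) S)%:R) <=
  expR (\sum_(B in F) (- p ^+ #|B| +
    \sum_(C in F | (C != B) && ~~ [disjoint B & C]) p ^+ #|B :|: C|%SET)).
Proof.
apply: le_trans (janson_seq (enum_uniq _)) _; rewrite ler_expR big_enum /=.
by apply: ler_sum => B _; rewrite lerD2l big_enum_cond.
Qed.

End BernoulliSubset.

(** * Inversion classes in a group of odd order *)

Section OddOrder.
Context (G : finZmodType) (oddG : odd #|G|).

(** Translation by [x] permutes the group, so it does not change the sum of all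
    the elements. *)
Lemma mulrn_card (x : G) : x *+ #|G| = 0.
Proof.
have /eqP : \sum_(g : G) (g + x) = \sum_(g : G) g.
  rewrite (reindex_inj (h := fun g => g - x)) /=; last exact: addIr.
  by apply: eq_bigr => g _; rewrite subrK.
by rewrite big_split /= -subr_eq0 addrAC subrr add0r sumr_const => /eqP.
Qed.

Lemma mulr2n_inj : injective (fun x : G => x *+ 2).
Proof.
move=> x y /= /eqP; rewrite -subr_eq0 -mulrnBl => /eqP xy2.
have := mulrn_card (x - y).
rewrite -(odd_double_half #|G|) oddG add1n mulrS -mul2n mulrnA xy2 mul0rn addr0.
by move/eqP; rewrite subr_eq0 => /eqP.
Qed.

Lemma opp_neq (x : G) : x != 0 -> - x != x.
Proof.
apply: contraNN => /eqP xx; apply/eqP/mulr2n_inj.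
by rewrite mul0rn mulr2n -{1}xx addNr.
Qed.

End OddOrder.

Section Classes.
Import mathcomp.boot.fintype mathcomp.boot.finset.
Context (G : finZmodType).
Implicit Types (a b x : G) (xi : inversion_class G).
Local Notation Q := (inversion_class G).

Lemma mem_inv_class a b : (b \in inv_class a) = (b == a) || (b == - a).
Proof. by rewrite !inE. Qed.

Lemma mem_inv_classes a : (inv_class a \in inv_classes G) = (a != 0).
Proof.
apply/imsetP/idP => [[b]|a0]; last by exists a; rewrite ?inE.
rewrite !inE => b0 ab; apply: contra_neq b0 => a0.
have : b \in inv_class a by rewrite ab !inE eqxx.
by rewrite a0 mem_inv_class oppr0 orbb => /eqP.
Qed.

(** Being partial, this gives no class to [0], so that the zero terms of a sum
    do not contribute to the set of classes it uses. *)
Definition class_opt a : option Q := insub (inv_class a).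

Lemma inv_class_eq a b : b \in inv_class a -> inv_class b = inv_class a.
Proof.
rewrite mem_inv_class => /orP[] /eqP -> //.
by apply/setP => x; rewrite !inE opprK orbC.
Qed.

Lemma mem_class a xi : (a \in val xi) = (class_opt a == Some xi).
Proof.
rewrite /class_opt; case: insubP => [eta _ ea|].
  apply/idP/eqP => [axi|[<-]]; last by rewrite ea mem_inv_class eqxx.
  congr Some; apply: val_inj; rewrite ea.
  have /imsetP[b _ xib] := valP xi.
  by rewrite xib; apply: inv_class_eq; rewrite -xib.
rewrite mem_inv_classes negbK => /eqP ->; apply/negbTE/negP => xi0.
have /imsetP[b] := valP xi; rewrite !inE => b0 xib; move: xi0.
by rewrite xib mem_inv_class eq_sym (negbTE b0) eq_sym oppr_eq0 (negbTE b0).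
Qed.

Lemma class_opt_eq0 a : (class_opt a == None) = (a == 0).
Proof.
rewrite /class_opt; case: insubP => [eta|]; rewrite mem_inv_classes.
  by move=> /negbTE ->.
by rewrite negbK => ->.
Qed.

Lemma class_optP a b : (class_opt a == class_opt b) = (a == b) || (a == - b).
Proof.
have [->|b0] := eqVneq b 0.
  by rewrite oppr0 orbb (eqP (_ : class_opt 0 == None)) class_opt_eq0.
case E : (class_opt b) => [xi|]; last by move/eqP: E; rewrite class_opt_eq0 (negbTE b0).
have := mem_class b xi; rewrite E eqxx => bxi.
rewrite -mem_class; have /imsetP[c _ xic] := valP xi.
by rewrite xic in bxi *; rewrite -(inv_class_eq bxi) mem_inv_class.
Qed.

(** The default value is never reached, since inversion classes are nonempty. *)
Definition class_repr xi : G := odflt 0 [pick x in val xi].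

Lemma class_reprP xi : class_repr xi \in val xi.
Proof.
rewrite /class_repr; case: pickP => //= e.
have /imsetP[c _ xic] := valP xi.
by have := e c; rewrite /= xic mem_inv_class eqxx.
Qed.

Lemma class_opt_repr xi : class_opt (class_repr xi) = Some xi.
Proof. by apply/eqP; rewrite -mem_class class_reprP. Qed.

Lemma class_repr_inj : injective class_repr.
Proof. by move=> x y e; apply: Some_inj; rewrite -!class_opt_repr e. Qed.

Lemma class_opt_surj a : a != 0 -> exists xi, a \in val xi.
Proof.
rewrite -class_opt_eq0; case E : (class_opt a) => [xi|//] _.
by exists xi; rewrite mem_class E.
Qed.

Lemma mem_connection_set (S : {set Q}) a :
  (a \in connection_set S) = [exists xi in S, class_opt a == Some xi].
Proof.
apply/bigcupP/existsP => [[xi xiS]|[xi /andP[xiS axi]]].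
  by rewrite mem_class => axi; exists xi; rewrite xiS.
by exists xi; rewrite // mem_class.
Qed.

Lemma connection_setN (S : {set Q}) a :
  (- a \in connection_set S) = (a \in connection_set S).
Proof.
rewrite !mem_connection_set (eqP (_ : class_opt (- a) == class_opt a)) //.
by rewrite class_optP eqxx orbT.
Qed.

Lemma card_class (oddG : odd #|G|) xi : #|val xi| = 2.
Proof.
have /imsetP[c] := valP xi; rewrite !inE => c0 ->.
by rewrite cards2 eq_sym opp_neq.
Qed.

Lemma leq_card_bigcup (I T : finType) (D : pred I) (F : I -> {set T}) :
  (#|\bigcup_(i | D i) F i| <= \sum_(i | D i) #|F i|)%N.
Proof.
elim/big_rec2: _ => [|i m A _ IH]; first by rewrite cards0.
by apply: leq_trans (leq_card_setU _ _) _; rewrite leq_add2l.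
Qed.

Lemma card_connection_set (oddG : odd #|G|) (S : {set Q}) :
  (#|connection_set S| <= 2 * #|S|)%N.
Proof.
apply: leq_trans (leq_card_bigcup _ _) _.
by rewrite mulnC -sum_nat_const; apply: leq_sum => xi _; rewrite card_class.
Qed.

(** Double counting of the pairs formed by a class and one of its elements. *)
Lemma card_inversion_class (oddG : odd #|G|) : (#|G| = (2 * #|{: Q}|).+1)%N.
Proof.
have memE a : (\sum_(xi : Q) (a \in val xi) = (a != 0)%R)%N.
  rewrite -class_opt_eq0; under eq_bigr do rewrite mem_class.
  case: (class_opt a) => [eta|]; last by rewrite big1.
  by rewrite (bigD1 eta) //= eqxx big1 // => xi /negbTE; rewrite eq_sym => h; 
    apply/eqP; rewrite eqb0; apply/eqP => -[e]; rewrite e eqxx in h.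
rewrite (cardD1 0) inE add1n -sum1_card; congr _.+1.
transitivity (\sum_(a : G) \sum_(xi : Q) (a \in val xi))%N.
  rewrite big_mkcond /=; apply: eq_bigr => a _; rewrite memE !inE andbT.
  by case: eqP.
rewrite exchange_big /= mulnC -sum_nat_const; apply: eq_bigr => xi _.
by rewrite -[RHS](card_class oddG xi) -sum1_card [RHS]big_mkcond;
  apply: eq_bigr => a _; case: (_ \in _).
Qed.

End Classes.

(** * Counting representations by distinct classes *)

Section Fibers.
Import mathcomp.boot.fintype mathcomp.boot.finset.
Context (T U : finType) (f : T -> U) (E : {set T}) (m : nat).

(** Counting along the fibers of [f]; the next two lemmas compare the sizes of
    a set and of its image. *)
Lemma card_fibers : (#|E| = \sum_(B in f @: E) #|[set y in E | f y == B]|)%N.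
Proof.
rewrite -sum1_card (partition_big_imset f) /=; apply: eq_bigr => B _.
by rewrite -sum1_card; apply: eq_bigl => y; rewrite inE.
Qed.

Lemma leq_card_fibers :
  (forall y, y \in E -> (#|[set z in E | f z == f y]| <= m)%N) ->
  (#|E| <= #|f @: E| * m)%N.
Proof.
move=> Em; rewrite card_fibers -sum_nat_const; apply: leq_sum => _ /imsetP[y yE ->].
exact: Em.
Qed.

Lemma geq_card_fibers :
  (forall y, y \in E -> (m <= #|[set z in E | f z == f y]|)%N) ->
  (#|f @: E| * m <= #|E|)%N.
Proof.
move=> Em; rewrite card_fibers -sum_nat_const; apply: leq_sum => _ /imsetP[y yE ->].
exact: Em.
Qed.

End Fibers.

Section Tuples.
Import mathcomp.boot.fintype mathcomp.boot.finset.
Context (G : finZmodType) (oddG : odd #|G|) (d : nat).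
Local Notation Q := (inversion_class G).
Local Notation N := #|G|.
Local Notation tup := {ffun 'I_d -> G}.
Implicit Types (y z : tup) (A : {set tup}) (K D : {set 'I_d}) (X : {set G}).

Definition total y : G := \sum_i y i.

(** The graph reaches [total y] by the steps [y i], null steps being idle, as
    soon as all of these classes are active. *)
Definition classes y : {set Q} := [set xi : Q | [exists i, y i \in val xi]].

Lemma mem_classes y xi : (xi \in classes y) = [exists i, class_opt (y i) == Some xi].
Proof. by rewrite inE; apply: eq_existsb => i; rewrite mem_class. Qed.

Lemma imset_classes y : Some @: classes y \subset [set class_opt (y i) | i : 'I_d].
Proof.
apply/subsetP => _ /imsetP[xi + ->]; rewrite mem_classes => /existsP[i /eqP <-].
exact: imset_f.
Qed.

Lemma card_classes y : (#|classes y| <= d)%N.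
Proof.
rewrite -(card_imset _ (@Some_inj _));
  apply: leq_trans (subset_leq_card (imset_classes y)) _.
by rewrite -[leqRHS]card_ord; exact: leq_imset_card.
Qed.

Lemma card_classesP y : #|classes y| = d <->
  injective (fun i => class_opt (y i)) /\ (forall i, y i != 0).
Proof.
split=> [cd|[yi y0]].
  have e : Some @: classes y = [set class_opt (y i) | i : 'I_d].
    apply/eqP; rewrite eqEcard imset_classes card_imset ?cd; last exact: Some_inj.
    by rewrite -[leqRHS]card_ord leq_imset_card.
  split=> [i j ij|i].
    have /imset_injP h : #|[set class_opt (y i) | i in 'I_d]| == #|'I_d|.
      by rewrite -e card_imset ?cd ?card_ord; last exact: Some_inj.
    exact: h.
  rewrite -class_opt_eq0.
  have : class_opt (y i) \in Some @: classes y by rewrite e; apply/imsetP; exists i.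
  by case/imsetP => xi _ ->.
rewrite -(card_imset _ (@Some_inj _)) -[RHS]card_ord -(card_imset _ yi).
apply: eq_card; apply/subset_eqP; rewrite imset_classes /=.
apply/subsetP => _ /imsetP[i _ ->].
case E : (class_opt (y i)) => [xi|]; last by move/eqP: E;
  rewrite class_opt_eq0 (negbTE (y0 i)).
by apply: imset_f; rewrite mem_classes; apply/existsP; exists i; rewrite E.
Qed.

(** Restriction to [K] is injective on [A]. Zero is only a filler outside of
    [K]. *)
Lemma leq_card_determined A K :
  (forall y z, y \in A -> z \in A -> {in K, y =1 z} -> y = z) ->
  (#|A| <= N ^ #|K|)%N.
Proof.
move=> AK; pose f y : tup := [ffun i => if i \in K then y i else 0].
have fi : {in A &, injective f}.
  move=> y z yA zA /ffunP e; apply: AK => // i iK.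
  by have := e i; rewrite !ffunE iK.
rewrite -(card_in_imset fi) -(cardsT G) -(card_pffun_on 0).
apply: subset_leq_card; apply/subsetP => _ /imsetP[y _ ->].
apply/pffun_onP; split=> [|_ /imageP[i _ ->]]; last by rewrite inE.
by apply/subsetP => i; rewrite inE ffunE; case: ifP; rewrite ?eqxx.
Qed.

Lemma total_eq_off y z (i : 'I_d) : total y = total z ->
  (forall j, j != i -> y j = z j) -> y = z.
Proof.
rewrite /total (bigD1 i) //= [RHS](bigD1 i) //= => + yz.
rewrite (eq_bigr z yz) => /addIr yzi.
by apply/ffunP => j; have [->|/yz] := eqVneq j i.
Qed.

Lemma card_setC1_ord (i : 'I_d) K : i \notin K -> #|~: (i |: K)| = (d - #|K|.+1)%N.
Proof. by move=> iK; rewrite cardsCs setCK card_ord cardsU1 iK. Qed.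

Lemma card_total_prescribed (x : G) (v : tup) K :
  (#|K| < d)%N ->
  (#|[set y | (total y == x) && [forall i in K, y i == v i]]| <= N ^ (d - #|K|.+1))%N.
Proof.
move=> Kd.
have [i iK] : exists i, i \notin K.
  apply/existsP; rewrite -negb_forall; apply: contraL Kd => /forallP KT.
  by rewrite -leqNgt (_ : K = setT) ?cardsT ?card_ord //; apply/setP => i; rewrite !inE KT.
rewrite -(card_setC1_ord iK); apply: leq_card_determined => y z.
rewrite !inE => /andP[/eqP ty /forall_inP Ky] /andP[/eqP tz /forall_inP Kz] yz.
apply: (@total_eq_off _ _ i); first by rewrite ty.
move=> j ji; case: (boolP (j \in K)) => jK;
  first by rewrite (eqP (Ky j jK)) (eqP (Kz j jK)).
by apply: yz; rewrite !inE negb_or ji.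
Qed.

Lemma card_total_le (x : G) : (0 < d)%N -> (#|[set y | total y == x]| <= N ^ d.-1)%N.
Proof.
move=> d0; have := @card_total_prescribed x [ffun=> 0] set0;
  rewrite cards0 subn1 => /(_ d0).
apply: leq_trans; apply: subset_leq_card; apply/subsetP => y; rewrite !inE => ->.
by apply/forall_inP => i; rewrite inE.
Qed.

(** The upper bound holds for each of the [N] values of the sum, and all the
    bounds add up to the exact number of tuples. *)
Lemma card_total (x : G) : (0 < d)%N -> #|[set y | total y == x]| = (N ^ d.-1)%N.
Proof.
move=> d0.
have le x' := card_total_le x' d0.
have sumE : (\sum_(x' : G) #|[set y | total y == x']| = N * N ^ d.-1)%N.
  rewrite -expnS prednK //; have := card_ffun 'I_d G; rewrite card_ord => <-.
  rewrite -sum1_card.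
  rewrite (partition_big total predT) //=; apply: eq_bigr => x' _.
  by rewrite -sum1_card; apply: eq_bigl => y; rewrite inE.
apply/eqP; rewrite eqn_leq le /= -(leq_add2r (\sum_(x' : G | x' != x) N ^ d.-1)).
rewrite sum_nat_const.
have cx : #|[pred x' | x' != x]| = N.-1 by rewrite -(cardC1 x).
rewrite cx -mulSn prednK; last by apply/card_gt0P; exists 0.
rewrite -sumE (bigD1 x) //= leq_add2l -cx -sum_nat_const.
by apply: leq_sum.
Qed.

(** The other coordinates determine [y i *+ 2], hence [y i] and [y j]. *)
Lemma card_total_collision (x : G) (i j : 'I_d) : i != j ->
  (#|[set y | (total y == x) && (y i == y j)]| <= N ^ d.-2)%N.
Proof.
move=> ij; rewrite (_ : d.-2 = #|~: (j |: [set i])|); last first.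
  by rewrite card_setC1_ord ?inE 1?eq_sym // cards1 subn2.
apply: leq_card_determined => y z; rewrite !inE.
move=> /andP[/eqP ty /eqP yij] /andP[/eqP tz /eqP zij] yz.
have yz' k : (k != i) && (k != j) -> y k = z k.
  by move=> /andP[ki kj]; apply: yz; rewrite !inE negb_or kj.
have : total y = total z by rewrite ty.
rewrite /total (bigD1 i) //= (bigD1 j) 1?eq_sym //= [RHS](bigD1 i) //=
  [in RHS](bigD1 j) 1?eq_sym //=.
rewrite (eq_bigr z yz') !addrA => /addIr.
rewrite -yij -zij -!mulr2n => /(mulr2n_inj oddG) yzi.
apply/ffunP => k; have [->//|ki] := eqVneq k i.
by have [->|kj] := eqVneq k j; rewrite -?yij -?zij // yz' // ki.
Qed.

(** Pick [i] in [D] and [j] outside: the other coordinates determine [y i]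
    through the sum over [D], and then [y j] through the total. *)
Lemma card_total_subsum (x x' : G) D : D != set0 -> D != setT ->
  (#|[set y | (total y == x) && (x - (\sum_(i in D) y i) *+ 2 == x')%R]| <= N ^ d.-2)%N.
Proof.
move=> /set0Pn[i iD] DT.
have [j jD] : exists j, j \notin D.
  by apply/existsP; rewrite -negb_forall; apply: contraNN DT => /forallP DT;
    apply/eqP/setP => j; rewrite inE DT.
have ij : i != j by apply: contraNneq jD => <-.
rewrite (_ : d.-2 = #|~: (j |: [set i])|); last first.
  by rewrite card_setC1_ord ?inE 1?eq_sym // cards1 subn2.
apply: leq_card_determined => y z; rewrite !inE.
move=> /andP[/eqP ty /eqP yD] /andP[/eqP tz /eqP zD] yz.
have yz' k : k != i -> k != j -> y k = z k.
  by move=> ki kj; apply: yz; rewrite !inE negb_or kj.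
have : (\sum_(i in D) y i) *+ 2 = (\sum_(i in D) z i) *+ 2.
  by apply/oppr_inj/(addrI x); rewrite yD zD.
move=> /(mulr2n_inj oddG); rewrite (bigD1 i) //= [RHS](bigD1 i) //=.
rewrite (eq_bigr z); last first.
  by move=> k /andP[kD ki]; apply: yz' => //; apply: contraNneq jD => <-.
move=> /addIr yzi; apply: (@total_eq_off _ _ j); first by rewrite ty.
by move=> k kj; have [->//|ki] := eqVneq k i; exact: yz'.
Qed.

(** Changing the signs of the coordinates in [D] subtracts twice their sum from
    [total y]; no such change, other than a void or global one, may produce an
    element of [X]. As [total y] itself belongs to [X], no proper partial sum
    vanishes. *)
Definition generic X y := [&& total y \in X, injectiveb y &
  [forall D : {set 'I_d}, (D != set0) && (D != setT) ==>
     (total y - (\sum_(i in D) y i) *+ 2 \notin X)]].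

Context (d_ge2 : (2 <= d)%N).

(** Partial sums over one or two coordinates show that no coordinate vanishes
    and that no two are opposite. *)
Lemma generic_classes X y : (forall x, x \in X -> - x \notin X) ->
  generic X y -> #|classes y| = d.
Proof.
move=> XN /and3P[tX /injectiveP yi /forallP yD].
have X0 : 0 \notin X by apply/negP => X0; have := XN _ X0; rewrite oppr0 X0.
have subsum D : D != set0 -> D != setT -> \sum_(i in D) y i != 0.
  move=> D0 DT; have := yD D; rewrite D0 DT /=; apply: contraNneq => ->.
  by rewrite mul0rn subr0.
have set_neqT D : (#|D| < d)%N -> D != setT.
  by apply: contraTneq => ->; rewrite cardsT card_ord ltnn.
apply/card_classesP; split=> [i j /eqP|i].
  rewrite class_optP => /orP[/eqP/yi//|/eqP yij].
  apply/eqP/negP => /negP ij.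
  have s0 : \sum_(k in [set i; j]) y k = 0.
    by rewrite big_setU1 ?inE //= big_set1 yij addNr.
  have [T|/subsum] := eqVneq [set i; j] setT.
    move: X0; rewrite -s0 T (eq_bigl predT) ?tX // => k; exact: in_setT.
  rewrite s0 eqxx => h; suff: false by [].
  by apply: h; apply/set0Pn; exists i; rewrite !inE eqxx.
have : [set i] != set0 :> {set 'I_d} by apply/set0Pn; exists i; rewrite inE.
move=> /subsum; rewrite big_set1; apply.
by apply: set_neqT; rewrite cards1.
Qed.

(** A second tuple with the same classes as [y] is, up to a permutation, [y]
    with the signs of a set [D] of coordinates changed; its sum then differs
    from that of [y] by twice the sum of [y] over [D]. Genericity excludes this
    when [D] is proper and nonempty, and a global change of sign would give two
    opposite elements of [X]. *)
Lemma generic_fiber X y z : (forall x, x \in X -> - x \notin X) ->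
  generic X y -> total z \in X -> classes z = classes y ->
  exists s : {perm 'I_d}, z = [ffun i => y (s i)].
Proof.
move=> XN gy tz zy; have cy := generic_classes XN gy.
have /card_classesP[yi y0] := cy.
have /card_classesP[zi z0] : #|classes z| = d by rewrite zy.
have zyE i : exists j, class_opt (z i) == class_opt (y j).
  have [xi zxi] := class_opt_surj (z0 i).
  have : xi \in classes z by rewrite inE; apply/existsP; exists i.
  rewrite zy mem_classes => /existsP[j /eqP yj]; exists j.
  by rewrite yj -mem_class.
pose f i := xchoose (zyE i); have fE i : class_opt (z i) = class_opt (y (f i)).
  exact/eqP/(xchooseP (zyE i)).
have fi : injective f by move=> i j ij; apply: zi; rewrite /= !fE ij.
pose s := perm fi; exists s.
pose D := [set j | z ((s^-1)%g j) != y j].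
have zD j : z ((s^-1)%g j) = if j \in D then - y j else y j.
  have := fE ((s^-1)%g j); rewrite -[f _](permE fi) permKV => /eqP.
  by rewrite class_optP inE; case: eqP => //= _ /eqP.
have totalz : total z = total y - (\sum_(i in D) y i) *+ 2.
  rewrite /total (reindex_inj (@perm_inj _ (s^-1)%g)) /=.
  rewrite (bigID (mem D)) /= [\sum_i y i](bigID (mem D)) /=.
  rewrite (eq_bigr (fun j => - y j)); last by move=> j jD; rewrite zD jD.
  rewrite [X in _ + X](eq_bigr y); last by move=> j /negbTE jD; rewrite zD jD.
  by rewrite sumrN mulr2n opprD addrACA subrr add0r addrC.
case/and3P: gy => ty _ /forallP/(_ D); rewrite -totalz tz implybF.
have [D0 _|_ /=] := eqVneq D set0.
  apply/ffunP => i; rewrite ffunE; have := zD (s i); rewrite permK => ->.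
  by rewrite D0 inE.
rewrite negbK => /eqP DT; have := XN _ ty.
move: tz; rewrite totalz DT [\sum_(i in _) _](eq_bigl predT) => [|i]; last exact: in_setT.
by rewrite mulr2n opprD addrA subrr add0r => ->.
Qed.

(** Only the sets of exactly [d] classes are retained: they are the typical
    ones, and distinct members of the same size are not nested. *)
Definition rep_family X : {set {set Q}} :=
  classes @: [set y | (total y \in X) && (#|classes y| == d)].

Lemma rep_familyP X (B : {set Q}) :
  reflect (exists y, [/\ total y \in X, #|classes y| = d & B = classes y])
    (B \in rep_family X).
Proof.
apply: (iffP imsetP) => [[y]|[y [ty cy ->]]].
  by rewrite inE => /andP[ty /eqP cy] ->; exists y.
by exists y; rewrite ?inE ?ty ?cy ?eqxx.
Qed.

Lemma card_rep_family_mem X B : B \in rep_family X -> #|B| = d.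
Proof. by case/rep_familyP => y [_ + ->]. Qed.

Lemma card_total_in X : #|[set y | total y \in X]| = (#|X| * N ^ d.-1)%N.
Proof.
rewrite -sum1_card (partition_big total (mem X)) /=; last by move=> y; rewrite inE.
rewrite -sum_nat_const; apply: eq_bigr => x xX.
rewrite -(card_total x) ?(ltnW d_ge2) // -sum1_card; apply: eq_bigl => y.
by rewrite !inE; case: eqP => [->|_]; rewrite ?xX ?andbF.
Qed.

(** The [d`!] rearrangements of a tuple with distinct classes are distinct, and
    they have the same sum and the same classes. *)
Lemma card_rep_family_le X : (#|rep_family X| * d`! <= #|X| * N ^ d.-1)%N.
Proof.
rewrite -card_total_in.
apply: leq_trans (_ : #|[set y | (total y \in X) && (#|classes y| == d)]| <= _)%N;
  last first.
  by apply: subset_leq_card; apply/subsetP => y; rewrite !inE => /andP[].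
apply: geq_card_fibers => y; rewrite inE => /andP[ty /eqP cy].
have /card_classesP[yi _] := cy.
have yi' : injective y by move=> i j ij; apply: yi; rewrite /= ij.
rewrite -(card_Sn d).
pose g (s : {perm 'I_d}) : tup := [ffun i => y (s i)].
have gi : injective g.
  by move=> s t /ffunP st; apply/permP => i; apply: yi'; have := st i; rewrite !ffunE.
rewrite -(card_imset _ gi); apply: subset_leq_card; apply/subsetP => _ /imsetP[s _ ->].
have cg : classes (g s) = classes y.
  apply/setP => xi; rewrite !mem_classes; apply/existsP/existsP => -[i];
    rewrite ?ffunE => h.
    by exists (s i).
  by exists ((s^-1)%g i); rewrite ffunE permKV.
rewrite !inE cg cy !eqxx !andbT; move: ty; rewrite /total (reindex_inj (@perm_inj _ s)).
by under eq_bigr do rewrite -[y _](ffunE (fun i => y (s i))).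
Qed.

(** By [generic_fiber], at most [d`!] generic tuples have a given set of
    classes. *)
Lemma card_generic_le X : (forall x, x \in X -> - x \notin X) ->
  (#|[set y | generic X y]| <= #|rep_family X| * d`!)%N.
Proof.
move=> XN; apply: leq_trans (_ : #|classes @: [set y | generic X y]| * d`! <= _)%N.
  apply: leq_card_fibers => y; rewrite inE => gy.
  rewrite -(card_Sn d).
  apply: leq_trans (leq_imset_card (fun s : {perm 'I_d} => [ffun i => y (s i)] : tup) _).
  apply: subset_leq_card; apply/subsetP => z; rewrite !inE => /andP[/and3P[tz _ _] /eqP zy].
  have [s ->] := generic_fiber XN gy tz zy.
  by apply: imset_f; rewrite inE.
rewrite leq_mul2r; apply/orP; right; apply: subset_leq_card; apply: imsetS.
apply/subsetP => y; rewrite !inE => gy; rewrite (generic_classes XN gy) eqxx andbT.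
by case/and3P: gy.
Qed.

(** A tuple of given sum fails to be generic through a pair of equal
    coordinates, or through a set of coordinates and an element of [X]. *)
Definition nongeneric_bound (k : nat) : nat := d * d + 2 ^ d * k.

(** Each way of failing to be generic costs one more degree of freedom. *)
Lemma card_generic_ge X :
  (#|X| * N ^ d.-1 <= #|[set y | generic X y]| + #|X| * nongeneric_bound #|X| * N ^ d.-2)%N.
Proof.
rewrite -card_total_in.
(* The two ways of failing to be generic: a repeated coordinate, or a partial
   sum leading to another element x' of X. *)
pose coll (x : G) (ij : 'I_d * 'I_d) := [set y | (total y == x) && (y ij.1 == y ij.2)].
pose sub (x x' : G) D :=
  [set y | (total y == x) && (x - (\sum_(i in D) y i) *+ 2 == x')%R].
pose bad := \bigcup_(x in X) (\bigcup_(ij | ij.1 != ij.2) coll x ij :|: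
  \bigcup_(D | (D != set0) && (D != setT)) \bigcup_(x' in X) sub x x' D).
apply: leq_trans (_ : #|[set y | generic X y] :|: bad| <= _)%N.
  apply: subset_leq_card; apply/subsetP => y; rewrite !inE => ty.
  apply/orP; case: (boolP (generic X y)) => [|ng]; [by left|right].
  apply/bigcupP; exists (total y) => //; rewrite inE.
  move: ng; rewrite /generic ty /= negb_and => /orP[/injectivePn[i [j ij yij]]|].
    by apply/orP; left; apply/bigcupP; exists (i, j); rewrite //= inE eqxx yij eqxx.
  rewrite negb_forall => /existsP[D]; rewrite negb_imply negbK => /andP[D0T h].
  apply/orP; right; apply/bigcupP; exists D => //; apply/bigcupP; eexists; first exact: h.
  by rewrite inE !eqxx.
apply: leq_trans (leq_card_setU _ _) _; rewrite leq_add2l -mulnA -sum_nat_const.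
apply: leq_trans (leq_card_bigcup _ _) _; apply: leq_sum => x xX.
apply: leq_trans (leq_card_setU _ _) _; rewrite mulnDl leq_add //.
  apply: leq_trans (leq_card_bigcup _ _) _.
  apply: leq_trans (_ : \sum_(ij : 'I_d * 'I_d) N ^ d.-2 <= _)%N; last first.
    by rewrite sum_nat_const card_prod card_ord.
  rewrite [leqLHS]big_mkcond; apply: leq_sum => ij _; case: ifP => // ij12.
  exact: card_total_collision.
apply: leq_trans (leq_card_bigcup _ _) _.
apply: leq_trans (_ : \sum_(D : {set 'I_d}) #|X| * N ^ d.-2 <= _)%N; last first.
  by rewrite sum_nat_const -mulnA (_ : #|_| = 2 ^ d)%N // -cardsT -powersetT
    card_powerset cardsT card_ord.
rewrite [leqLHS]big_mkcond; apply: leq_sum => D _; case: ifP => // /andP[D0 DT].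
apply: leq_trans (leq_card_bigcup _ _) _; rewrite -sum_nat_const.
by apply: leq_sum => x' _; exact: card_total_subsum.
Qed.

(** Together with [card_rep_family_le], this determines the size of the family
    up to a relative error [O(1 / N)]. *)
Lemma card_rep_family_ge X : (forall x, x \in X -> - x \notin X) ->
  (#|X| * N ^ d.-1 <= #|rep_family X| * d`! + #|X| * nongeneric_bound #|X| * N ^ d.-2)%N.
Proof.
move=> XN; apply: leq_trans (card_generic_ge X) _.
by rewrite leq_add2r card_generic_le.
Qed.

Lemma card_ffun_connection (B : {set Q}) : (#|B| <= d)%N ->
  (#|[set y : tup | [forall i, (y i \in 0 |: connection_set B)%R]]| <= (2 * d).+1 ^ d)%N.
Proof.
move=> Bd; rewrite -[X in (_ <= _ ^ X)%N]card_ord.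
apply: leq_trans (_ : #|(0%R : G) |: connection_set B| ^ #|'I_d| <= _)%N.
  rewrite -card_ffun_on; apply: subset_leq_card; apply/subsetP => y.
  by rewrite inE => /forallP yB; apply/ffun_onP.
rewrite leq_exp2r ?card_ord ?(ltnW d_ge2) //.
apply: leq_trans (leq_card_setU _ _) _; rewrite cards1 add1n ltnS.
by apply: leq_trans (card_connection_set oddG _) _; rewrite leq_mul2l Bd.
Qed.

Lemma connection_set_classes y (B : {set Q}) :
  [forall i, y i \in 0 |: connection_set B] = (classes y \subset B).
Proof.
apply/forallP/subsetP => [yB xi|yB i].
  rewrite mem_classes => /existsP[i yi]; move: (yB i).
  rewrite !inE -class_opt_eq0 (eqP yi) /= mem_connection_set.
  by move=> /existsP[eta /andP[eB]]; rewrite (eqP yi) => /eqP[->].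
rewrite !inE; have [//|yi0 /=] := eqVneq (y i) 0.
have [xi yxi] := class_opt_surj yi0; rewrite mem_connection_set.
apply/existsP; exists xi; rewrite -mem_class yxi andbT; apply: yB.
by rewrite inE; apply/existsP; exists i.
Qed.

(** Every coordinate is zero or belongs to one of the classes in [B], which
    have two elements each. *)
Lemma card_classes_eq (B : {set Q}) : (#|B| <= d)%N ->
  (#|[set y | classes y == B]| <= (2 * d).+1 ^ d)%N.
Proof.
move=> /card_ffun_connection; apply: leq_trans; apply: subset_leq_card.
by apply/subsetP => y; rewrite !inE connection_set_classes => /eqP ->.
Qed.

(** Each member containing [I] has a tuple in which [#|I|] coordinates take
    values in the classes of [I]. Given these values and their positions, the
    sum determines one more coordinate, and [d - #|I|.+1] remain free. *)
Lemma card_rep_family_above X (I : {set Q}) : (#|I| < d)%N ->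
  (#|[set B in rep_family X | I \subset B]| <=
     #|X| * (2 * d).+1 ^ d * N ^ (d - #|I|.+1))%N.
Proof.
move=> Id.
pose supp (v : tup) := [set i | v i != 0].
pose cand := [set v : tup | [forall i, v i \in 0 |: connection_set I] & #|supp v| == #|I|].
pose ext (x : G) (v : tup) := [set y | (total y == x) && [forall i in supp v, y i == v i]].
apply: leq_trans (_ : #|\bigcup_(x in X) \bigcup_(v in cand) ext x v| <= _)%N.
  apply: leq_trans (leq_imset_card classes _); apply: subset_leq_card.
  apply/subsetP => B; rewrite inE => /andP[/rep_familyP[y [ty cy ->]] Iy].
  have /card_classesP[yi y0] := cy.
  apply: imset_f; apply/bigcupP; exists (total y) => //.
  pose v : tup := [ffun i => if y i \in connection_set I then y i else 0].
  have suppE : supp v = [set i | y i \in connection_set I].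
    by apply/setP => i; rewrite !inE ffunE; case: ifP; rewrite ?eqxx ?y0.
  apply/bigcupP; exists v; last first.
    rewrite inE eqxx suppE; apply/forall_inP => i.
    by rewrite inE ffunE => ->.
  rewrite inE; apply/andP; split.
    by apply/forallP => i; rewrite ffunE !inE; case: ifP => [->|]; rewrite ?orbT ?eqxx.
  rewrite -(card_imset _ yi) -(card_imset (mem I) (@Some_inj _)) suppE.
  apply/eqP/eq_card; apply/subset_eqP/andP; split; apply/subsetP => c /imsetP[].
    move=> i; rewrite inE mem_connection_set => /existsP[xi /andP[xiI /eqP ->]] ->.
    exact: imset_f.
  move=> xi xiI ->; have := subsetP Iy _ xiI; rewrite mem_classes => /existsP[i /eqP yxi].
  rewrite -yxi; apply/imsetP; exists i => //; rewrite inE mem_connection_set.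
  by apply/existsP; exists xi; rewrite xiI yxi eqxx.
rewrite -mulnA -sum_nat_const; apply: leq_trans (leq_card_bigcup _ _) _.
apply: leq_sum => x xX; apply: leq_trans (leq_card_bigcup _ _) _.
apply: leq_trans (_ : \sum_(v in cand) N ^ (d - #|I|.+1) <= _)%N.
  apply: leq_sum => v; rewrite inE => /andP[_ /eqP vI]; rewrite -vI;
    apply: card_total_prescribed.
  by rewrite vI.
rewrite sum_nat_const leq_mul2r; apply/orP; right.
apply: leq_trans (card_ffun_connection (ltnW Id)).
by apply: subset_leq_card; apply/subsetP => v; rewrite !inE => /andP[].
Qed.

End Tuples.

(** * Binomial moments of the number of far classes *)

Lemma bin_le_expn n k : ('C(n, k) <= n ^ k)%N.
Proof.
elim: k n => [|k IH] n; first by rewrite bin0 expn0.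
have [->|n0] := posnP n; first by rewrite bin0n.
rewrite -(leq_pmul2l (ltn0Sn k)) mul_bin_left.
apply: leq_trans (_ : n * n ^ k <= _)%N; first by rewrite leq_mul ?leq_subr.
by rewrite -expnS leq_pmull.
Qed.

Section Estimates.
Import mathcomp.boot.fintype mathcomp.boot.finset.
Context (R : realType) (G : finZmodType) (oddG : odd #|G|) (d : nat) (d_ge2 : (2 <= d)%N).
Context (p : R) (p_ge0 : 0 <= p) (p_le1 : p <= 1) (Np_ge1 : 1 <= #|G|%:R * p).
Local Notation Q := (inversion_class G).
Local Notation N := #|G|.
Local Notation M := #|{: Q}|.
Local Notation tup := {ffun 'I_d -> G}.
Local Notation E := (@expect R Q p).
Implicit Types (S B C I : {set Q}) (X : {set G}) (y : tup).

Let N_gt0 : 0 < N%:R :> R.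
Proof. by rewrite ltr0n; apply/card_gt0P; exists 0. Qed.

Definition far S (x : G) := [forall y : tup, (total y == x) ==> ~~ (classes y \subset S)].

Definition short S (x : G) :=
  [exists y : tup, [&& total y == x, (#|classes y| < d)%N & classes y \subset S]].

(** Being far is the conjunction of two decreasing events, one for each kind of
    sum, which Harris' inequality lets one treat separately. *)
Lemma far_in_avoids X S :
  [forall x in X, far S x] = avoids (enum (rep_family d X)) S &&
    [forall x in X, ~~ short S x].
Proof.
apply/forall_inP/andP => [fX|[/allP FX sX] x xX].
  split; first apply/allP => B.
    rewrite mem_enum => /rep_familyP[y [ty cy ->]].
    by have /forallP/(_ y) := fX _ ty; rewrite eqxx.
  apply/forall_inP => x /fX /forallP xX; apply/existsPn => y; have := xX y.
  by case: eqP => //= _ /negbTE ->; rewrite andbF.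
apply/forallP => y; apply/implyP => /eqP ty; apply/negP => yS.
have [cy|cy] := ltnP #|classes y| d.
  move/forall_inP: sX => /(_ x xX)/existsPn/(_ y).
  by rewrite ty eqxx cy yS.
have : classes y \in enum (rep_family d X).
  rewrite mem_enum; apply/rep_familyP; exists y; rewrite ty; split => //.
  by apply/eqP; rewrite eqn_leq cy card_classes.
by move/FX; rewrite yS.
Qed.

(** One factor [k] for each member of a pair, [2 ^ d] choices for their
    intersection, and the constant of [card_rep_family_above]. *)
Definition overlap_bound (k : nat) : nat := k * k * (2 * d).+1 ^ d * 2 ^ d.

Lemma overlap_term_le (s : nat) : (0 < s < d)%N ->
  N%:R ^+ (d - s.+1) * p ^+ (2 * d - s) <= (N%:R * p) ^+ (2 * d).-1 / N%:R ^+ d.+1.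
Proof.
move=> /andP[s0 sd]; rewrite ler_pdivlMr ?exprn_gt0 // mulrAC -exprD.
rewrite (_ : (d - s.+1 + d.+1 = 2 * d - s)%N); last by lia.
by rewrite -exprMn ler_weXn2l //; lia.
Qed.

Lemma card_rep_family_crude X : (#|rep_family d X| <= #|X| * N ^ d.-1)%N.
Proof.
apply: leq_trans (card_rep_family_le d_ge2 X).
by rewrite leq_pmulr ?fact_gt0.
Qed.

(** Two distinct members that meet have as intersection some [I] with
    [0 < #|I| < d]. There are [O(N ^ (2 * d - 2 - #|I|))] pairs with an
    intersection of size [#|I|], each active with probability
    [p ^+ (2 * d - #|I|)]; since [1 <= N * p], the worst case is
    [#|I| = 1]. *)
Lemma overlap_le X :
  \sum_(B in rep_family d X) \sum_(C in rep_family d X | (C != B) && ~~ [disjoint B & C])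
    p ^+ #|B :|: C| <=
  (overlap_bound #|X|)%:R * ((N%:R * p) ^+ (2 * d).-1 / N%:R ^+ 2).
Proof.
set t := N%:R * p; set F := rep_family d X.
have inner B : B \in F ->
    \sum_(C in F | (C != B) && ~~ [disjoint B & C]) p ^+ #|B :|: C| <=
    (2 ^ d * (#|X| * (2 * d).+1 ^ d))%:R * (t ^+ (2 * d).-1 / N%:R ^+ d.+1).
  move=> BF; have cB := card_rep_family_mem BF.
  (* The other member C is classified by its intersection I with B. *)
  rewrite (partition_big (fun C => B :&: C)
      (fun I => (I \in powerset B) && (0 < #|I| < d)%N)) /=; last first.
    move=> C /and3P[CF CB BC]; have cC := card_rep_family_mem CF.
    rewrite powersetE subsetIl /= card_gt0 setI_eq0 BC /= -[in X in (_ < X)%N]cB ltn_neqAle.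
    rewrite subset_leq_card ?subsetIl // andbT; apply: contra_neqN CB => cI.
    apply/eqP; rewrite eq_sym eqEcard cC cB leqnn andbT; apply/setIidPl/eqP.
    by rewrite eqEcard subsetIl (eqP cI) leqnn.
  rewrite natrM -mulrA.
  have <- : \sum_(I in powerset B) (#|X| * (2 * d).+1 ^ d)%:R *
      (t ^+ (2 * d).-1 / N%:R ^+ d.+1) =
      (2 ^ d)%:R * ((#|X| * (2 * d).+1 ^ d)%:R * (t ^+ (2 * d).-1 / N%:R ^+ d.+1)) :> R.
    by rewrite sumr_const card_powerset cB -[LHS]mulr_natl.
  rewrite big_mkcondr; apply: ler_sum => I _ /=.
  have t0 : 0 <= t by apply: mulr_ge0; rewrite ?ler0n.
  case: ifP => [Id|_]; last by rewrite !mulr_ge0 ?invr_ge0 ?exprn_ge0 ?ler0n.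
  apply: (@le_trans _ _ (\sum_(C in [set C in F | I \subset C]) p ^+ (2 * d - #|I|))).
    rewrite [leLHS]big_mkcond [leRHS]big_mkcond; apply: ler_sum => C _ /=.
    case: ifP => [/andP[/and3P[CF _ _] /eqP BC]|_]; last by case: ifP => _;
      rewrite ?exprn_ge0.
    by rewrite inE CF -BC subsetIr cardsU cB (card_rep_family_mem CF) mul2n addnn.
  rewrite sumr_const -[leLHS]mulr_natl.
  have Id' : (#|I| < d)%N by case/andP: Id.
  apply: (@le_trans _ _ ((#|X| * (2 * d).+1 ^ d * N ^ (d - #|I|.+1))%:R * p ^+
    (2 * d - #|I|))).
    by rewrite ler_wpM2r ?exprn_ge0 // ler_nat card_rep_family_above.
  rewrite natrM natrX -mulrA ler_wpM2l ?ler0n //.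
  exact: overlap_term_le.
apply: (@le_trans _ _ (\sum_(B in F) (2 ^ d * (#|X| * (2 * d).+1 ^ d))%:R *
     (t ^+ (2 * d).-1 / N%:R ^+ d.+1))); first exact: ler_sum.
rewrite sumr_const -[leLHS]mulr_natl mulrA -natrM.
apply: (@le_trans _ _ ((#|X| * N ^ d.-1 * (2 ^ d * (#|X| * (2 * d).+1 ^ d)))%:R *
     (t ^+ (2 * d).-1 / N%:R ^+ d.+1))).
  rewrite ler_wpM2r ?mulr_ge0 ?invr_ge0 ?exprn_ge0 ?ler0n ?mulr_ge0 //.
  by rewrite ler_nat leq_mul2r card_rep_family_crude orbT.
rewrite (_ : (#|X| * N ^ d.-1 * (2 ^ d * (#|X| * (2 * d).+1 ^ d)) =
   overlap_bound #|X| * N ^ d.-1)%N); last by rewrite /overlap_bound; ring.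
rewrite natrM -mulrA ler_wpM2l ?ler0n // natrX mulrCA.
rewrite (_ : d.+1 = (d.-1 + 2)%N); last by lia.
by rewrite exprD invfM mulVKf // ?expf_neq0 ?gt_eqF.
Qed.

(** To leading order, the expected number of active sets of [d] classes that
    represent a given element. *)
Definition intensity : R := N%:R ^+ d.-1 * p ^+ d / d`!%:R.

Let fact_gt0R : 0 < d`!%:R :> R. Proof. by rewrite ltr0n fact_gt0. Qed.

Lemma Np_expd : (N%:R * p) ^+ d = N%:R * (d`!%:R * intensity).
Proof.
rewrite /intensity [d`!%:R * _]mulrC divfK ?gt_eqF // mulrA -exprS prednK ?exprMn //.
exact: ltnW.
Qed.

(** Janson's inequality for the family of representing sets. *)
Lemma far_upper X : (forall x, x \in X -> - x \notin X) ->
  E (fun S => [forall x in X, far S x]%:R) <=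
  expR (- (#|X|%:R * intensity) + (#|X| * nongeneric_bound d #|X|)%:R * (intensity / N%:R) +
    (overlap_bound #|X|)%:R * (d`!%:R * intensity * ((N%:R * p) ^+ d.-1 / N%:R))).
Proof.
move=> XN; apply: le_trans (_ : _ <= E (fun S => (avoids (enum (rep_family d X)) S)%:R)) _.
  apply: le_expect => // S; rewrite far_in_avoids ler_nat.
  by case: (avoids _ _); case: [forall x in _, _].
apply: le_trans (janson p_ge0 p_le1 _) _; rewrite ler_expR big_split /=; apply: lerD.
  rewrite (eq_bigr (fun=> - p ^+ d)) => [|B BF]; last by rewrite (card_rep_family_mem BF).
  have -> : \sum_(B in rep_family d X) - p ^+ d = - (#|rep_family d X|%:R * p ^+ d).
    by rewrite sumr_const mulNrn mulr_natl.
  rewrite lerNl opprD opprK lerBlDr.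
  have q0 : 0 <= p ^+ d / d`!%:R by rewrite divr_ge0 ?exprn_ge0 ?ler0n.
  have := card_rep_family_ge oddG d_ge2 XN; rewrite -(ler_nat R) => /(ler_wpM2r q0).
  rewrite natrD !(natrM _ _ (_ ^ _)) (natrM _ #|rep_family d X|) !natrX mulrDl.
  rewrite (_ : #|X|%:R * N%:R ^+ d.-1 * (p ^+ d / d`!%:R) = #|X|%:R * intensity);
    last first.
    by rewrite /intensity; ring.
  rewrite (_ : #|rep_family d X|%:R * d`!%:R * (p ^+ d / d`!%:R) = #|rep_family d X|%:R
    * p ^+ d); last first.
    by rewrite -mulrA [d`!%:R * _]mulrC divfK // gt_eqF.
  rewrite (_ : _ * N%:R ^+ d.-2 * (p ^+ d / d`!%:R) =
     (#|X| * nongeneric_bound d #|X|)%:R * (intensity / N%:R)) //.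
  rewrite /intensity (_ : d.-1 = d.-2.+1); last by lia.
  by rewrite exprSr; field; rewrite !gt_eqF.
apply: le_trans (overlap_le X) _; rewrite ler_wpM2l ?ler0n //.
rewrite (_ : (2 * d).-1 = (d + d.-1)%N); last by lia.
rewrite exprD Np_expd le_eqVlt; apply/orP; left; apply/eqP.
by field; rewrite gt_eqF.
Qed.

(** A lower counterpart of [1 - q <= expR (- q)], obtained from
    [(1 - q)^-1 = 1 + q / (1 - q)] and [q / (1 - q) <= q * (1 + 2 * q)]. *)
Lemma ge_expR_1B (q : R) : 0 <= q -> q <= 2^-1 -> expR (- (q * (1 + 2 * q))) <= 1 - q.
Proof.
move=> q0 q1; rewrite expRN -[leRHS]invrK lef_pV2 ?posrE ?expR_gt0 ?invr_gt0 //;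
  last by lra.
apply: le_trans (expR_ge1Dx _); rewrite -[leLHS]mul1r ler_pdivrMr; last by lra.
nra.
Qed.

Definition short_prob (x : G) : R := E (fun S => (short S x)%:R).

Lemma short_prob_ge0 x : 0 <= short_prob x.
Proof. by apply: expect_ge0 => // S; rewrite ler0n. Qed.

(** Harris' inequality separates the representing sets from the short sums; the
    former are avoided one by one, the latter by a union bound. *)
Lemma far_lower X : p ^+ d <= 2^-1 ->
  expR (- (#|X|%:R * intensity * (1 + 2 * p ^+ d))) * (1 - \sum_(x in X) short_prob x) <=
  E (fun S => [forall x in X, far S x]%:R).
Proof.
move=> pd.
pose f S : R := (avoids (enum (rep_family d X)) S)%:R.
pose g S : R := [forall x in X, ~~ short S x]%:R.
have fd : decreasing f by exact: decreasing_avoids.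
have gd : decreasing g.
  move=> A B AB; rewrite ler_nat.
  case: (boolP [forall x in X, ~~ short B x]) => //= /forall_inP hB.
  rewrite (_ : [forall x in X, ~~ short A x]) //; apply/forall_inP => x /hB.
  apply: contraNN => /existsP[y /and3P[ty cy yA]]; apply/existsP; exists y.
  by rewrite ty cy (subset_trans yA AB).
have -> : E (fun S => [forall x in X, far S x]%:R) = E (fun S => f S * g S).
  by apply: eq_expect => S; rewrite far_in_avoids /f /g -natrM mulnb.
have f0 : 0 <= E f by apply: expect_ge0 => // S; rewrite ler0n.
have g0 S : 0 <= g S by rewrite ler0n.
have gE : 1 - \sum_(x in X) short_prob x <= E g.
  rewrite -expect_sum -[X in X - _](expect_cst Q p) -expectB.
  apply: le_expect => // S; rewrite /g lerBlDr.
  have [_|] := boolP [forall x in X, ~~ short S x].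
    by rewrite ler_wpDr ?sumr_ge0 // => x _; rewrite ler0n.
  rewrite negb_forall_in => /exists_inP[x xX]; rewrite negbK => sx.
  by rewrite add0r (bigD1 x) //= sx lerDl sumr_ge0 // => x' _; rewrite ler0n.
have fE : expR (- (#|X|%:R * intensity * (1 + 2 * p ^+ d))) <= E f.
  apply: le_trans (expect_avoids_ge p_ge0 p_le1 _).
  rewrite big_enum /= (eq_bigr (fun=> 1 - p ^+ d)) => [|B BF];
    last by rewrite (card_rep_family_mem BF).
  rewrite prodr_const; have q0 := exprn_ge0 d p_ge0.
  apply: le_trans (lerXn2r _ _ _ (ge_expR_1B q0 pd)); rewrite ?nnegrE ?expR_ge0 //;
    last by lra.
  rewrite -expRM_natl ler_expR mulrN lerN2 mulrA ler_wpM2r //; first by lra.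
  rewrite /intensity !mulrA ler_pdivlMr // mulrAC ler_wpM2r //.
  by rewrite -natrX -!natrM ler_nat card_rep_family_le.
apply: le_trans (harris p_ge0 p_le1 fd gd).
have [s0|s0] := leP 0 (1 - \sum_(x in X) short_prob x).
  by apply: ler_pM; rewrite ?expR_ge0.
apply: (@le_trans _ _ 0); last by rewrite mulr_ge0 // expect_ge0.
by rewrite pmulr_rle0 ?expR_gt0 // ltW.
Qed.

Let Np_ge0 : 0 <= N%:R * p. Proof. by rewrite mulr_ge0 ?ler0n. Qed.

Lemma leq_class_card : (M <= N)%N.
Proof. by rewrite (card_inversion_class oddG) mul2n -addnn ltnW // ltnS leq_addr. Qed.

(** A set of [j] classes is used by boundedly many tuples, and there are at
    most [N ^ j] such sets, each active with probability [p ^+ j]; as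
    [1 <= N * p], the largest [j = d.-1] dominates. *)
Lemma sum_short_prob :
  \sum_(x : G) short_prob x <= ((2 * d).+1 ^ d * d)%:R * (N%:R * p) ^+ d.-1.
Proof.
apply: (@le_trans _ _ (\sum_(x : G) \sum_(y : tup | (total y == x) && (#|classes y| < d)%N)
    p ^+ #|classes y|)).
  apply: ler_sum => x _.
  under [leRHS]eq_bigr do rewrite -(@expect_subset R Q p).
  rewrite -expect_sum; apply: le_expect => // S.
  have [/existsP[y /and3P[ty cy yS]]|_] := boolP (short S x);
    last by rewrite sumr_ge0 // => y _; rewrite ler0n.
  by rewrite (bigD1 y) ?ty //= yS lerDl sumr_ge0 // => z _; rewrite ler0n.
have -> : \sum_(x : G) \sum_(y : tup | (total y == x) && (#|classes y| < d)%N) p ^+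
  #|classes y| =
    \sum_(y : tup | (#|classes y| < d)%N) p ^+ #|classes y|.
  rewrite [RHS](partition_big (@total G d) predT) //=; apply: eq_bigr => x _.
  by apply: eq_bigl => y; rewrite andbC.
rewrite (partition_big (@classes G d) (fun B => #|B| < d)%N) //=.
apply: (@le_trans _ _ (\sum_(B : {set Q} | (#|B| < d)%N) ((2 * d).+1 ^ d)%:R * p ^+ #|B|)).
  apply: ler_sum => B Bd.
  rewrite (eq_bigr (fun=> p ^+ #|B|)) => [|y /andP[_ /eqP ->] //].
  rewrite sumr_const -[leLHS]mulr_natl ler_wpM2r ?exprn_ge0 // ler_nat.
  apply: leq_trans (card_classes_eq oddG d_ge2 (ltnW Bd)).
  by apply: subset_leq_card; apply/subsetP => y; rewrite !inE => /andP[_].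
rewrite -mulr_sumr natrM -mulrA ler_wpM2l ?ler0n //.
have -> : \sum_(B : {set Q} | (#|B| < d)%N) p ^+ #|B| = \sum_(j < d) 'C(M, j)%:R * p ^+ j.
  rewrite (partition_big (fun B : {set Q} => inord #|B| : 'I_d.-1.+1) predT) //=.
  have -> : \sum_(j < d) 'C(M, j)%:R * p ^+ j = \sum_(j < d.-1.+1) 'C(M, j)%:R * p ^+ j.
    by rewrite prednK // ltnW.
  apply: eq_bigr => j _; rewrite (eq_bigl (fun B : {set Q} => #|B| == j)) => [|B].
    rewrite (eq_bigr (fun=> p ^+ j)) => [|B /eqP -> //].
    by rewrite -big_set /= sumr_const -card_draws mulr_natl.
  apply/andP/eqP => [[Bd /eqP <-]|Bj]; first by rewrite inordK // prednK // ltnW.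
  split; first by rewrite Bj; have := ltn_ord j; lia.
  by apply/eqP/val_inj; rewrite /= inordK ?Bj.
apply: (@le_trans _ _ (\sum_(j < d) (N%:R * p) ^+ d.-1));
  last by rewrite sumr_const card_ord -[leLHS]mulr_natl.
apply: ler_sum => j _; apply: (@le_trans _ _ ((N%:R * p) ^+ j)).
  rewrite exprMn ler_wpM2r ?exprn_ge0 // -natrX ler_nat.
  apply: leq_trans (bin_le_expn _ _) _.
  by case: (val j) => // i; rewrite leq_exp2r // leq_class_card.
by rewrite ler_weXn2l //; have := ltn_ord j; lia.
Qed.

Definition far_classes S : {set Q} := [set xi | far S (class_repr xi)].

Definition moment (k : nat) : R := E (fun S => 'C(#|far_classes S|, k)%:R).

Lemma moment_sum k : moment k = \sum_(X : {set Q} | #|X| == k)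
  E (fun S => [forall x in [set class_repr xi | xi in X], far S x]%:R).
Proof.
rewrite -expect_sum; apply: eq_expect => S.
rewrite -cards_draws -sum1_card natr_sum [LHS]big_mkcond [RHS]big_mkcond /=.
apply: eq_bigr => X _; rewrite inE andbC; case: (#|X| == k) => //=.
have -> : (X \subset far_classes S) = [forall x in [set class_repr xi | xi in X], far S x].
  apply/subsetP/forall_inP => [XS _ /imsetP[xi xiX ->]|XS xi xiX].
    by have := XS _ xiX; rewrite inE.
  by rewrite inE; apply: XS; exact: imset_f.
by case: [forall x in _, _].
Qed.

Lemma class_repr_antisym (X : {set Q}) (x : G) :
  x \in [set class_repr xi | xi in X] -> - x \notin [set class_repr xi | xi in X].
Proof.
case/imsetP => xi xiX ->; apply/negP => /imsetP[eta etaX e].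
have xe : xi = eta.
  apply: Some_inj; rewrite -!class_opt_repr -e; apply/eqP.
  by rewrite class_optP opprK eqxx orbT.
have : class_opt (class_repr xi) != None by rewrite class_opt_repr.
rewrite class_opt_eq0 => /(opp_neq oddG); rewrite {1}e -xe; by rewrite eqxx.
Qed.

Lemma moment_upper k : moment k <= 'C(M, k)%:R *
  expR (- (k%:R * intensity) + (k * nongeneric_bound d k)%:R * (intensity / N%:R) +
    (overlap_bound k)%:R * (d`!%:R * intensity * ((N%:R * p) ^+ d.-1 / N%:R))).
Proof.
rewrite moment_sum -card_draws mulr_natl -sumr_const big_set /=.
apply: ler_sum => X /eqP Xk.
apply: le_trans (far_upper (@class_repr_antisym X)) _.
by rewrite card_imset ?Xk //; exact: class_repr_inj.
Qed.

(** Stated with a factor [M] so that no predecessor of [k] appears. *)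
Lemma card_draws_mem k (xi : Q) :
  (#|[set X : {set Q} | (#|X| == k) && (xi \in X)]| * M <= M ^ k)%N.
Proof.
case: k => [|k].
  rewrite (_ : [set X | _] = set0) ?cards0 ?mul0n //; apply/setP => X; rewrite !inE.
  by apply/negbTE/negP => /andP[]; rewrite cards_eq0 => /eqP ->; rewrite inE.
rewrite expnSr leq_mul2r; apply/orP; right.
apply: leq_trans (bin_le_expn _ _); rewrite -card_draws.
(* Removing xi leaves a set of size k. *)
have inj : {in [set X : {set Q} | (#|X| == k.+1) && (xi \in X)] &, injective
  (fun X : {set Q} => X :\ xi)}.
  move=> X Y; rewrite !inE => /andP[_ xX] /andP[_ xY] e.
  by rewrite -(setD1K xX) e setD1K.
rewrite -(card_in_imset inj); apply: subset_leq_card; apply/subsetP => _ /imsetP[X + ->].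
rewrite !inE => /andP[/eqP Xk xX]; have := cardsD1 xi X; rewrite xX Xk add1n => -[<-].
by rewrite eqxx.
Qed.

(** The errors due to short sums are averaged over all [X]: every class belongs
    to the same small proportion of the sets of size [k]. *)
Lemma moment_lower k : p ^+ d <= 2^-1 ->
  expR (- (k%:R * intensity * (1 + 2 * p ^+ d))) *
  ('C(M, k)%:R - (M ^ k)%:R * (((2 * d).+1 ^ d * d)%:R * (N%:R * p) ^+ d.-1 / M%:R)) <=
    moment k.
Proof.
move=> pd; rewrite moment_sum.
apply: (@le_trans _ _ (\sum_(X : {set Q} | #|X| == k)
  expR (- (k%:R * intensity * (1 + 2 * p ^+ d))) *
    (1 - \sum_(xi in X) short_prob (class_repr xi)))); last first.
  apply: ler_sum => X /eqP Xk.
  have := far_lower [set class_repr xi | xi in X] pd.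
  rewrite card_imset ?Xk; last exact: class_repr_inj.
  by rewrite big_imset //= => ? ? _ _; exact: class_repr_inj.
rewrite -mulr_sumr ler_wpM2l ?expR_ge0 // sumrB -big_set sumr_const -card_draws.
rewrite lerD2l lerN2 (exchange_big_dep predT) //=.
apply: (@le_trans _ _ (\sum_(xi : Q) ((M ^ k)%:R / M%:R) * short_prob (class_repr xi))).
  apply: ler_sum => xi _; rewrite -big_set sumr_const -[leLHS]mulr_natl.
  rewrite ler_wpM2r ?short_prob_ge0 // ler_pdivlMr.
    by rewrite -natrM ler_nat card_draws_mem.
  by rewrite ltr0n; apply/card_gt0P; exists xi.
rewrite -mulr_sumr [leRHS]mulrA [leRHS]mulrAC ler_wpM2l ?divr_ge0 ?ler0n //.
apply: le_trans sum_short_prob.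
apply: (@le_trans _ _ (\sum_(x in [set class_repr xi | xi in [set: Q]]) short_prob x)).
  rewrite big_imset /=; last by move=> ? ? _ _; exact: class_repr_inj.
  by rewrite le_eqVlt; apply/orP; left; apply/eqP/eq_bigl => xi; rewrite in_setT.
by rewrite [leLHS]big_mkcond; apply: ler_sum => x _; case: ifP => // _;
  exact: short_prob_ge0.
Qed.

End Estimates.

(** * Distances in the Cayley graph *)

Section Distance.
Context (R : realType) (V : Type) (e : rel V).

Lemma gdist_leP (d : nat) (x z : V) :
  (gdist R e x z <= d%:R%:E)%E <->
  exists s : seq V, [/\ path e x s, last x s = z & (size s <= d)%N].
Proof.
split=> [|[s [xs sz sd]]]; last first.
  apply: (@le_trans _ _ (size s)%:R%:E); last by rewrite lee_fin ler_nat.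
  by apply: ereal_inf_lbound; exists s.
move=> le_d; apply: contrapT => none.
have : (d.+1%:R%:E <= gdist R e x z)%E.
  apply: le_ereal_inf_tmp => _ [s [xs sz] <-]; rewrite lee_fin ler_nat ltnNge.
  by apply/negP => sd; apply: none; exists s.
move=> /le_trans/(_ le_d); rewrite lee_fin ler_nat.
by rewrite ltnn.
Qed.

Lemma diameter_leP (d : nat) :
  (diameter R e <= d%:R%:E)%E <-> forall x z, (gdist R e x z <= d%:R%:E)%E.
Proof.
split=> [D x z|D].
  by apply: le_trans D; apply: ereal_sup_ubound; exists (x, z).
by apply: ge_ereal_sup => _ [[x z] _ <-]; exact: D.
Qed.

End Distance.

Section CayleyDistance.
Import mathcomp.boot.fintype mathcomp.boot.finset.
Context (R : realType) (G : finZmodType) (oddG : odd #|G|) (d : nat).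
Local Notation Q := (inversion_class G).
Implicit Types (S : {set Q}) (C : {set G}) (x z : G).

(** Padding with null steps turns walks of length at most [n] into sequences of
    exactly [n] steps. *)
Lemma cayley_walkP C n x z :
  (exists s, [/\ path (cayley C) x s, last x s = z & (size s <= n)%N]) <->
  exists t : seq G, [/\ size t = n, {subset t <= 0 |: C} & \sum_(a <- t) a = z - x].
Proof.
elim: n x => [|n IH] x.
  split=> [[[|a s] [_ /= sz sn]]|[[|a t] [tn _ st]]] //.
    by exists [::]; rewrite big_nil -sz subrr.
  move: st; rewrite big_nil => /esym/eqP; rewrite subr_eq0 => /eqP ->.
  by exists [::].
split=> [[[|a s] [xs sz sn]]|[[|a t] [tn tC]]] //.
- exists (nseq n.+1 0); rewrite size_nseq; split=> //.
    by move=> y /nseqP[-> _]; rewrite !inE eqxx.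
  by rewrite big1_seq -?sz ?subrr // => y /nseqP[].
- have /andP[xa as_] := xs.
  have /IH[t [tn tC st]] : exists s,
    [/\ path (cayley C) a s, last a s = z & (size s <= n)%N].
    by exists s.
  exists (a - x :: t); rewrite /= tn big_cons st; split=> //.
    by move=> y; rewrite inE => /orP[/eqP ->|/tC//]; rewrite !inE; move: xa;
      rewrite /cayley => ->; rewrite orbT.
  by rewrite addrC addrA subrK.
move: tn; rewrite big_cons => -[tn] st.
have tC' : {subset t <= 0 |: C} by move=> y yt; apply: tC; rewrite inE yt orbT.
have := tC a (mem_head _ _); rewrite !inE => /orP[/eqP a0|aC].
  have /IH[s [xs sz sn]] : exists t : seq G,
      [/\ size t = n, {subset t <= 0 |: C} & \sum_(b <- t) b = z - x].
    by exists t; rewrite -st a0 add0r.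
  by exists s; rewrite (leq_trans sn).
have /IH[s [xs sz sn]] : exists t : seq G,
    [/\ size t = n, {subset t <= 0 |: C} & \sum_(b <- t) b = z - (x + a)].
  by exists t; rewrite opprD addrA -st addrAC subrr add0r.
by exists (x + a :: s); rewrite /= /cayley addrAC subrr add0r aC.
Qed.

Lemma cayley_dist_leP C x z : (gdist R (cayley C) x z <= d%:R%:E)%E <->
  exists y : {ffun 'I_d -> G}, total y = z - x /\ [forall i, y i \in 0 |: C].
Proof.
split=> [/gdist_leP/cayley_walkP[t [td tC st]]|[y [ty /forallP yC]]].
  exists [ffun i : 'I_d => nth 0 t i]; split; last first.
    by apply/forallP => i; rewrite ffunE; apply/tC/mem_nth; rewrite td.
  rewrite -st (big_nth 0) big_mkord td; apply: eq_bigr => i _; exact: ffunE.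
apply/gdist_leP/cayley_walkP; exists [seq y i | i <- enum 'I_d].
rewrite size_map size_enum_ord big_map big_enum; split=> //.
by move=> _ /mapP[i _ ->].
Qed.

Lemma farE S x : far d S x = (d%:R%:E < gdist R (cayley (connection_set S)) 0%R x)%E.
Proof.
rewrite ltNge; apply/idP/negP => [/forallP fx /cayley_dist_leP[y []]|nfx].
  rewrite subr0 connection_set_classes => ty yS.
  by have := fx y; rewrite ty eqxx yS.
apply/forallP => y; apply/implyP => /eqP ty; apply/negP => yS; apply: nfx.
by apply/cayley_dist_leP; exists y; rewrite subr0 connection_set_classes.
Qed.

Lemma far0 S : ~~ far d S 0.
Proof.
rewrite negb_forall; apply/existsP; exists [ffun=> 0]; rewrite negb_imply negbK.
rewrite -connection_set_classes; apply/andP; split.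
  by rewrite /total big1 // => i _; rewrite ffunE.
by apply/forallP => i; rewrite ffunE !inE eqxx.
Qed.

Lemma farN S x : far d S (- x) = far d S x.
Proof.
suff imp z : far d S z -> far d S (- z) by apply/idP/idP => /imp; rewrite ?opprK.
move=> /forallP fz; apply/forallP => y; have := fz [ffun i => - y i].
rewrite -!connection_set_classes /total (eq_bigr (fun i => - y i)) => [|i _];
  last by rewrite ffunE.
rewrite sumrN (eq_sym _ (- z)) eqr_oppLR eq_sym => /implyP h; apply/implyP => /h.
apply: contraNN => /forallP yC; apply/forallP => i; have := yC i.
by rewrite ffunE !inE oppr_eq0 connection_setN.
Qed.

Lemma far_verticesE S :
  far_vertices R d (cayley (connection_set S)) = [set x | far d S x].
Proof.
apply/setP => x; rewrite !inE -farE; case: eqP => // ->.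
by rewrite (negbTE (far0 S)).
Qed.

Lemma far_classes_card S :
  #|[set inv_class x | x in far_vertices R d (cayley (connection_set S))]| =
    #|far_classes d S|.
Proof.
rewrite far_verticesE -[RHS](card_imset _ val_inj); apply: eq_card; apply/subset_eqP/andP.
have far_class (xi : Q) x : x \in val xi -> far d S x = far d S (class_repr xi).
  rewrite mem_class -(class_opt_repr xi) class_optP => /orP[] /eqP -> //.
  exact: farN.
split; apply/subsetP => C /imsetP[].
  move=> x; rewrite inE => fx ->.
  have x0 : x != 0 by apply: contraTneq fx => ->; exact: far0.
  have [xi xxi] := class_opt_surj x0.
  apply/imsetP; exists xi; first by rewrite inE -(far_class _ _ xxi).
  by have /imsetP[c _ xic] := valP xi; rewrite xic; apply: inv_class_eq; rewrite -xic.
move=> xi; rewrite inE => fxi ->; apply/imsetP; exists (class_repr xi);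
  first by rewrite inE.
have /imsetP[c _ xic] := valP xi; rewrite xic; apply/esym/inv_class_eq.
by rewrite -xic class_reprP.
Qed.

(** The far vertices are a union of inversion classes, which have two elements
    each. *)
Lemma far_vertices_card S :
  #|far_vertices R d (cayley (connection_set S))| =
  (2 * #|[set inv_class x | x in far_vertices R d (cayley (connection_set S))]|)%N.
Proof.
rewrite far_verticesE mulnC (card_fibers (@inv_class G)) -sum_nat_const.
apply: eq_bigr => _ /imsetP[x + ->]; rewrite inE => fx.
have x0 : x != 0 by apply: contraTneq fx => ->; exact: far0.
have c2 : #|inv_class x| = 2 by rewrite cards2 eq_sym opp_neq.
rewrite -[RHS]c2.
apply: eq_card => z; rewrite !inE -mem_inv_class; apply/andP/idP => [[_ /eqP <-]|zx].
  by rewrite mem_inv_class eqxx.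
rewrite (inv_class_eq zx) eqxx; split=> //.
by move: zx; rewrite mem_inv_class => /orP[] /eqP ->; rewrite ?farN.
Qed.

(** The condition of [cayley_dist_leP] depends on [z - x] only, so distances
    from [0] control all the others. *)
Lemma diameter_le_far S : (diameter R (cayley (connection_set S)) <= d%:R%:E)%E <->
  #|far_classes d S| = 0%N.
Proof.
rewrite -far_classes_card.
have -> : (#|[set inv_class x | x in far_vertices R d (cayley (connection_set S))]| =
  0%N <->
    forall x, ~~ far d S x).
  rewrite far_verticesE; split=> [/eqP + x|nf].
    rewrite cards_eq0 imset_eq0 => /eqP/setP/(_ x); by rewrite !inE => ->.
  by apply/eqP; rewrite cards_eq0 imset_eq0; apply/eqP/setP => x; rewrite !inE;
    exact/negbTE.
split=> [/diameter_leP D x|nf].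
  by rewrite farE -leNgt.
apply/diameter_leP => x z; have := nf (z - x); rewrite farE -leNgt.
move/cayley_dist_leP => [y [ty yC]]; apply/cayley_dist_leP; exists y; split=> //.
by rewrite ty subr0.
Qed.

End CayleyDistance.

(** * The law of the set of active classes *)

Section ActiveLaw.
Local Open Scope classical_set_scope.
Context (R : realType) (disp : measure_display) (Omega : measurableType disp)
  (P : probability Omega R) (G : finZmodType)
  (T : inversion_class G -> {RV P >-> R}).
Context (T_unif : forall xi, uniform01 (T xi)) (T_indep : mutually_independent T).
Context (r : R) (r_ge0 : 0 <= r) (r_le1 : r <= 1).
Local Notation Q := (inversion_class G).

Lemma uniform01_le xi : P (T xi @^-1` `]-oo, r]) = r%:E.
Proof.
have mr : measurable (`]-oo, r] : set R) by exact: measurable_itv.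
have := T_unif xi mr; rewrite /distribution /pushforward /= => ->.
rewrite /uniform_prob integral_uniform_pdf.
have -> : (`]-oo, r] `&` `[0, 1] = `[0, r] :> set R).
  apply/seteqP; split => x /=; rewrite !in_itv /=.
    by move=> [xr /andP[-> _]].
  by move=> /andP[-> xr]; rewrite xr (le_trans xr).
rewrite (eq_integral (cst 1%E)) => [|x]; last first.
  rewrite inE /= in_itv /= => /andP[x0 xr].
  by rewrite /uniform_pdf x0 (le_trans xr) // subr0 invr1.
rewrite integral_cst ?mul1e; last exact: measurable_itv.
apply: (etrans (lebesgue_measure_itv `[0, r]%R)); rewrite /= lte_fin.
by case: ltP => [_|r0]; rewrite ?sube0 //; congr EFin; apply/eqP; rewrite eq_le r_ge0 r0.
Qed.

Lemma prob_active_eq (S : {set Q}) : P [set w | active T r w = S] = (weight r S)%:E.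
Proof.
(* Independence is used for all the classes at once, each with the event that
   places it in S or outside. *)
pose A xi : set R := if xi \in S then `]-oo, r] else ~` `]-oo, r].
have mA xi : measurable (A xi) by rewrite /A; case: ifP => _ //; exact: measurableC.
have -> : [set w | active T r w = S] = \bigcap_(xi in [set` finset.setTfor Q]) T xi
  @^-1` A xi.
  apply/seteqP; split => w /=.
    move=> wS xi _ /=; rewrite /A -wS inE; case: ifPn => /= h; rewrite in_itv //=.
    exact/negP.
  move=> h; apply/setP => xi; rewrite inE; have := h xi; rewrite /= !inE => /(_ isT).
  by rewrite /A; case: ifP => _ /=; rewrite in_itv //= => /negP/negbTE.
rewrite T_indep // /weight -prodEFin; apply: eq_big => [xi|xi _]; first by rewrite inE.
rewrite /A; case: ifP => _; first exact: uniform01_le.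
have mT : measurable (T xi @^-1` `]-oo, r]).
  by rewrite -[X in measurable X]setTI; exact: measurable_funPT.
by rewrite preimage_setC probability_setC // uniform01_le.
Qed.

Lemma prob_active (a : pred {set Q}) :
  P [set w | a (active T r w)] = (expect r (fun S => (a S)%:R))%:E.
Proof.
have -> : [set w | a (active T r w)] = \bigcup_(S in [set` a]) [set w | active T r w = S].
  by apply/seteqP; split=> w /= => [aw|[S aS ->//]]; exists (active T r w).
rewrite measure_fin_bigcup //=.
- rewrite -(@bigfs _ _ _ _ (index_enum {set Q})) ?index_enum_uniq //; last first.
    by move=> S _; rewrite mem_index_enum.
  rewrite (eq_bigr (fun S => (weight r S)%:E)) => [|S _]; last exact: prob_active_eq.
  rewrite sumEFin /expect big_mkcond /=; congr EFin; apply: eq_bigr => S _.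
  by case: (a S); rewrite ?mulr1 ?mulr0.
- by move=> S S' _ _ [w [/= <- <-]].
- move=> S _; have := @measurable_active_fun _ _ _ _ _ T (fun A => A == S) r.
  move=> /(_ measurableT [set 1%N] I); rewrite setTI; congr measurable.
  by apply/seteqP; split=> w /=; [case: eqP|move=> ->; rewrite eqxx].
Qed.

End ActiveLaw.

(** * From binomial moments to total variation *)

Section Bonferroni.

(** Both sides count the pairs of disjoint subsets, of sizes [j] and [i], of a
    set of size [v]. *)
Lemma bin_trinomial v j i : ('C(j + i, j) * 'C(v, j + i) = 'C(v, j) * 'C(v - j, i))%N.
Proof.
have [jiv|vji] := leqP (j + i) v; last first.
  rewrite [X in (_ * X)%N]bin_small // muln0.
  have [jv|/bin_small -> //] := leqP j v.
  by rewrite ['C(v - j, i)]bin_small ?muln0 // ltn_subLR.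
have jv : (j <= v)%N by apply: leq_trans jiv; rewrite leq_addr.
have ivj : (i <= v - j)%N by rewrite leq_subRL.
have e1 := bin_fact (leq_addr i j); have e2 := bin_fact jiv.
have e3 := bin_fact jv; have e4 := bin_fact ivj.
rewrite addKn in e1; rewrite subnDA in e2.
apply/eqP; rewrite -(eqn_pmul2r (_ : 0 < j`! * i`! * (v - j - i)`!)%N) ?muln_gt0
  ?fact_gt0 //.
apply/eqP; transitivity v`!; first by rewrite -e2 -e1; ring.
by rewrite -e3 -e4; ring.
Qed.

(** By Pascal's rule the alternating sum telescopes. *)
Lemma alternating_bin_sum (R : comNzRingType) n m :
  \sum_(i < m.+1) (-1) ^+ i * 'C(n.+1, i)%:R = (-1) ^+ m * 'C(n, m)%:R :> R.
Proof.
elim: m => [|m IH]; first by rewrite big_ord1 !bin0.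
by rewrite big_ord_recr /= IH binS natrD exprS; ring.
Qed.

Context (R : realType).

Lemma alternating_bin_sum_dist n m :
  `|(n == 0)%N%:R - \sum_(i < m) (-1) ^+ i * 'C(n, i)%:R| <= 'C(n, m)%:R :> R.
Proof.
case: m => [|m]; first by rewrite big_ord0 subr0 bin0; case: n => [|n];
  rewrite /= ?normr1 ?normr0.
case: n => [|n].
  rewrite big_ord_recl /= big1 => [|i _]; last by rewrite bin0n /= mulr0.
  by rewrite bin0 mulr1 addr0 subrr normr0.
rewrite alternating_bin_sum sub0r normrN normrM normrX normrN1 expr1n mul1r ger0_norm //.
by rewrite ler_nat binS leq_addl.
Qed.

(** Bonferroni's inequalities for the event that exactly [j] of some events
    occur: the truncation error is at most the first omitted term. After
    [bin_trinomial], this is the case [j = 0] for the remaining [v - j]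
    events. *)
Lemma bonferroni v j m :
  `|(v == j)%:R - \sum_(i < m) (-1) ^+ i * ('C(j + i, j)%:R * 'C(v, j + i)%:R)|
    <= 'C(j + m, j)%:R * 'C(v, j + m)%:R :> R.
Proof.
rewrite -natrM bin_trinomial natrM.
have -> : \sum_(i < m) (-1) ^+ i * ('C(j + i, j)%:R * 'C(v, j + i)%:R) =
    'C(v, j)%:R * \sum_(i < m) (-1) ^+ i * 'C(v - j, i)%:R :> R.
  by rewrite mulr_sumr; apply: eq_bigr => i _; rewrite -natrM bin_trinomial natrM mulrCA.
have -> : (v == j)%:R = 'C(v, j)%:R * (v - j == 0)%N%:R :> R.
  have [->|vj] := eqVneq v j; first by rewrite binn subnn mulr1.
  rewrite subn_eq0; have [vj'|_] := leqP v j; last by rewrite mulr0.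
  by rewrite bin_small ?mul0r // ltn_neqAle vj.
rewrite -mulrBr normrM ger0_norm // ler_wpM2l //.
exact: alternating_bin_sum_dist.
Qed.

Lemma expect_bonferroni (Q : finType) (p : R) (v : {set Q} -> nat) j m :
  0 <= p -> p <= 1 ->
  `|expect p (fun S => (v S == j)%:R) -
    \sum_(i < m) (-1) ^+ i * ('C(j + i, j)%:R * expect p (fun S => 'C(v S, j + i)%:R))|
  <= 'C(j + m, j)%:R * expect p (fun S => 'C(v S, j + m)%:R).
Proof.
move=> p0 p1.
under eq_bigr do rewrite mulrA -expectZ.
rewrite -expect_sum -expectB -expectZ ler_norml -[X in - X]mul1r -mulNr -expectZ.
apply/andP; split; apply: le_expect => // S; rewrite ?mulN1r;
  have := bonferroni (v S) j m; rewrite ler_norml => /andP[lo hi];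
  by under eq_bigr do rewrite -mulrA.
Qed.

End Bonferroni.

Section MethodOfMoments.
Local Open Scope classical_set_scope.
Context (R : realType) (mu : R).

(** The Bonferroni sums of the Poisson law are proportional to the partial sums
    of the series of [expR (- mu)] and their errors tend to [0], so one first
    fixes a large [m] and then lets [n] grow. *)
Lemma cvg_pmf (u : nat -> R) (b : nat -> nat -> R) j :
  (forall k, b n k @[n --> \oo] --> mu ^+ k / k`!%:R) ->
  (\forall n \near \oo, forall m,
    `|u n - \sum_(i < m) (-1) ^+ i * ('C(j + i, j)%:R * b n (j + i)%N)|
      <= 'C(j + m, j)%:R * b n (j + m)%N) ->
  u n @[n --> \oo] --> mu ^+ j / j`!%:R * expR (- mu).
Proof.
move=> bk ub.
have coefE i x : 'C(j + i, j)%:R * (x ^+ (j + i) / (j + i)`!%:R) =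
    x ^+ j / j`!%:R * exp_coeff x i :> R.
  rewrite /exp_coeff /= -(bin_fact (leq_addr i j)) addKn !natrM exprD.
  by field; rewrite !pnatr_eq0 -!lt0n !fact_gt0 bin_gt0 leq_addr.
pose s m : R := \sum_(i < m) (-1) ^+ i * ('C(j + i, j)%:R * (mu ^+ (j + i) / (j + i)`!%:R)).
have sE m : s m = mu ^+ j / j`!%:R * series (exp_coeff (- mu)) m.
  rewrite /series /= big_mkord mulr_sumr; apply: eq_bigr => i _.
  by rewrite coefE /exp_coeff /= [(- mu) ^+ i]exprNn; ring.
pose t m : R := 'C(j + m, j)%:R * (mu ^+ (j + m) / (j + m)`!%:R).
have cs : s m @[m --> \oo] --> mu ^+ j / j`!%:R * expR (- mu).
  rewrite (_ : s = fun m => mu ^+ j / j`!%:R * series (exp_coeff (- mu)) m);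
    last exact/funext.
  by apply: cvgMl_tmp; exact: is_cvg_series_exp_coeff.
have ct : t m @[m --> \oo] --> (0 : R).
  rewrite (_ : t = fun m => mu ^+ j / j`!%:R * exp_coeff mu m);
    last by apply/funext => m; exact: coefE.
  by rewrite -(mulr0 (mu ^+ j / j`!%:R)); apply: cvgMl_tmp; exact: cvg_exp_coeff.
apply/cvgrPdist_le => eps eps0.
have e4 : 0 < eps / 4 by rewrite divr_gt0.
have [m [sm tm]] : exists m, `|mu ^+ j / j`!%:R * expR (- mu) - s m| <= eps / 4 /\ `|0
  - t m| <= eps / 4.
  move/cvgrPdist_le : cs => /(_ _ e4) cs; move/cvgrPdist_le : ct => /(_ _ e4) ct.
  by near \oo => m; exists m; split; near: m.
have cb : \sum_(i < m) (-1) ^+ i * ('C(j + i, j)%:R * b n (j + i)%N) @[n --> \oo] --> s m.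
  apply: cvg_big => [|i _]; first exact: add_continuous.
  by apply: cvgMl_tmp; apply: cvgMl_tmp; exact: bk.
have cbm : 'C(j + m, j)%:R * b n (j + m)%N @[n --> \oo] --> t m by apply: cvgMl_tmp;
  exact: bk.
move/cvgrPdist_le : cb => /(_ _ e4) cb; move/cvgrPdist_le : cbm => /(_ _ e4) cbm.
near=> n.
have h1 : `|u n - \sum_(i < m) (-1) ^+ i * ('C(j + i, j)%:R * b n (j + i)%N)|
      <= 'C(j + m, j)%:R * b n (j + m)%N by near: n; apply: filterS ub => n; apply.
have h2 : `|s m - \sum_(i < m) (-1) ^+ i * ('C(j + i, j)%:R * b n (j + i)%N)| <= eps /
  4 by near: n.
have h3 : `|t m - 'C(j + m, j)%:R * b n (j + m)%N| <= eps / 4 by near: n.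
move: sm tm h1 h2 h3.
set B := \sum_(i < m) _; set T := 'C(j + m, j)%:R * b n _.
rewrite !ler_norml => /andP[? ?] /andP[? ?] /andP[? ?] /andP[? ?] /andP[? ?].
by apply/andP; split; lra.
Unshelve. all: by end_near.
Qed.

End MethodOfMoments.

Section Scheffe.
Local Open Scope classical_set_scope.
Context (R : realType).
Implicit Types (mu nu : probability nat R) (A : set nat).

Lemma prob_fineU mu A B : A `&` B = set0 ->
  fine (mu (A `|` B)) = fine (mu A) + fine (mu B).
Proof.
by move=> AB; rewrite measureU // fineD // fin_num_measure.
Qed.

Lemma prob_initial_dist mu nu A K :
  `|fine (mu (A `&` `I_K)) - fine (nu (A `&` `I_K))| <=
  \sum_(k < K) `|fine (mu [set k : nat]) - fine (nu [set k : nat])|.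
Proof.
elim: K => [|K IH]; first by rewrite II0 setI0 !measure0 subrr normr0 big_ord0.
have dj : (A `&` `I_K) `&` (A `&` [set K]) = set0.
  by apply/seteqP; split=> k //= [[_ kK] [_ ke]]; rewrite ke ltnn in kK.
rewrite big_ord_recr /= IIS setIUr !prob_fineU //.
have [AK|AK] := pselect (A K); last first.
  have -> : A `&` [set K] = set0 by apply/seteqP; split=> k //= [Ak kK]; rewrite kK in Ak.
  by rewrite !measure0 !addr0 (le_trans IH) // lerDl.
have -> : A `&` [set K] = [set K] by apply/seteqP; split=> [k []//|k ->].
rewrite opprD addrACA; apply: le_trans (ler_normD _ _) _; exact: lerD.
Qed.

(** On an initial segment the two laws are compared point by point; outside of
    it, the mass of [mu] is that of [nu] up to the same comparison. *)
Lemma prob_dist_le mu nu A K :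
  `|fine (mu A) - fine (nu A)| <= (1 - fine (nu `I_K)) +
  2 * \sum_(k < K) `|fine (mu [set k : nat]) - fine (nu [set k : nat])|.
Proof.
have split (m : probability nat R) B :
    fine (m B) = fine (m (B `&` `I_K)) + fine (m (B `&` ~` `I_K)).
  rewrite -prob_fineU; first by rewrite -setIUr setUv setIT.
  by rewrite setIACA setICr setI0.
have tail (m : probability nat R) : 0 <= fine (m (A `&` ~` `I_K)) <= 1 - fine (m `I_K).
  have := split m setT; rewrite !setTI probability_setT /= => ->.
  rewrite addrAC subrr add0r fine_ge0 //=; apply: fine_le; rewrite ?fin_num_measure //.
  by apply: le_measure; rewrite ?inE // => x [].
have := prob_initial_dist mu nu A K; have := prob_initial_dist mu nu setT K.
have := tail mu; have := tail nu; rewrite (split mu A) (split nu A) !setTI.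
set D := \sum_(k < K) _.
have D0 : 0 <= D by apply: sumr_ge0.
rewrite !ler_norml => /andP[? ?] /andP[? ?] /andP[? ?] /andP[? ?].
by apply/andP; split; lra.
Qed.

Lemma dTV_le mu nu (a : R) :
  (forall A, `|fine (mu A) - fine (nu A)| <= a) -> (dTV mu nu <= a%:E)%E.
Proof.
move=> h; apply: ge_ereal_sup => _ [A _ <-].
by rewrite -(fineK (fin_num_measure mu A _)) // -(fineK (fin_num_measure nu A _)) //
  lee_fin h.
Qed.

Lemma dTV_ge0 mu nu : (0 <= dTV mu nu)%E.
Proof.
by apply: le_trans (ereal_sup_ubound _); last (exists set0 => //); rewrite abse_ge0.
Qed.

(** The limit is a probability, so an initial segment carries almost all of its
    mass, and then almost all of that of [mu_ n]. *)
Lemma scheffe (mu_ : nat -> probability nat R) nu :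
  (forall k : nat, fine (mu_ n [set k]) @[n --> \oo] --> fine (nu [set k])) ->
  dTV (mu_ n) nu @[n --> \oo] --> 0%E.
Proof.
move=> ck.
have cI : fine (nu `I_K) @[K --> \oo] --> (1 : R).
  apply: fine_cvg; rewrite -(probability_setT nu).
  have -> : [set: nat] = \bigcup_K `I_K.
    by apply/seteqP; split=> // k _; exists k.+1 => /=.
  apply: nondecreasing_cvg_mu => //.
  by move=> n m nm; apply/subsetPset => k /= kn; exact: leq_trans kn nm.
apply: cvg_EFin.
  near=> n; rewrite ge0_fin_numE ?dTV_ge0 //.
  apply: le_lt_trans (dTV_le (a := 1) _) (ltry _) => A.
  by have := prob_dist_le (mu_ n) nu A 0; rewrite II0 measure0 subr0 big_ord0 mulr0 addr0.
apply/cvgrPdist_le => eps eps0; have e2 : 0 < eps / 2 by rewrite divr_gt0.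
have [K IK] : exists K, `|1 - fine (nu `I_K)| <= eps / 2.
  move/cvgrPdist_le : cI => /(_ _ e2) cI.
  by near \oo => K; exists K; near: K.
have cD : 2 * \sum_(k < K) `|fine (mu_ n [set k : nat]) - fine (nu [set k : nat])|
    @[n --> \oo] --> (0 : R).
  have c0 : \sum_(k < K) `|fine (mu_ n [set k : nat]) - fine (nu [set k : nat])|
      @[n --> \oo] --> \sum_(k < K) (0 : R).
    apply: cvg_big => [|k _]; first exact: add_continuous.
    apply/norm_cvg0P; rewrite -(subrr (fine (nu [set (k : nat)]))).
    by apply: cvgB => //; exact: cvg_cst.
  have z : \sum_(k < K) (0 : R) = 0 by rewrite big1.
  by have := cvgMl_tmp (a := 2) c0; rewrite z mulr0 => h; exact: h.
move/cvgrPdist_le : cD => /(_ _ e2) cD.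
near=> n; have Dn : `|0 - 2 * \sum_(k < K) `|fine (mu_ n [set k : nat]) - fine
  (nu [set k : nat])| | <= eps / 2.
  by near: n.
have : (dTV (mu_ n) nu <= eps%:E)%E.
  apply: dTV_le => A; apply: le_trans (prob_dist_le _ _ A K) _.
  by move: IK Dn; rewrite !ler_norml => /andP[_ ?] /andP[? _]; lra.
have := dTV_ge0 (mu_ n) nu; rewrite /=; case: dTV => [a||] //=; rewrite !lee_fin => a0 ae.
by rewrite sub0r normrN ger0_norm.
Unshelve. all: by end_near.
Qed.

End Scheffe.

(** * Asymptotics at the threshold *)

Section Asymptotics.
Local Open Scope classical_set_scope.
Context (R : realType).

(** Lets one get rid of the [d]-th root in the definition of the threshold. *)
Lemma cvg0_of_expn (u : nat -> R) d : (0 < d)%N ->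
  u n ^+ d @[n --> \oo] --> 0 ->
  u n @[n --> \oo] --> 0.
Proof.
move=> d0 /cvgr0Pnorm_le ud; apply/cvgr0Pnorm_le => eps eps0.
near=> n.
have : `|u n ^+ d| <= eps ^+ d by near: n; apply: ud; rewrite exprn_gt0.
by rewrite normrX ler_pXn2r // nnegrE ?normr_ge0 // ltW.
Unshelve. all: by end_near.
Qed.

Lemma cvg0Ml (a : R) (u : nat -> R) : u n @[n --> \oo] --> 0 -> a * u n @[n --> \oo] --> 0.
Proof. by move=> u0; rewrite -[X in _ --> X](mulr0 a); exact: cvgMl_tmp. Qed.

Context (M : nat -> nat) (M_oo : M n @[n --> \oo] --> \oo).

Lemma cvg_inv_card : ((M n)%:R : R)^-1 @[n --> \oo] --> 0.
Proof.
apply/gtr0_cvgV0; last exact/cvgrnyP.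
by move/cvgnyPge : M_oo => /(_ 1%N); apply: filterS => n; rewrite ltr0n.
Qed.

(** The ratio of consecutive values of [k] is [(1 - k / M) / k.+1]. *)
Lemma cvg_bin_over_expn k :
  'C(M n, k)%:R / (M n)%:R ^+ k @[n --> \oo] --> (k`!%:R^-1 : R).
Proof.
elim: k => [|k IH].
  by apply: cvg_near_cst; apply: nearW => n; rewrite bin0 expr0 fact0 mul1r.
have step : k.+1%:R^-1 * ('C(M n, k)%:R / (M n)%:R ^+ k * (1 - k%:R * (M n)%:R^-1))
    @[n --> \oo] --> (k.+1%:R^-1 * (k`!%:R^-1 * (1 - k%:R * 0)) : R).
  apply: cvgMl_tmp; apply: cvgM => //; apply: cvgB; first exact: cvg_cst.
  by apply: cvgMl_tmp; exact: cvg_inv_card.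
move: step; rewrite mulr0 subr0 mulr1 -invfM -natrM -factS.
apply: cvg_trans; apply: near_eq_cvg; near=> n.
have kM : (k < M n)%N by near: n; move/cvgnyPge : M_oo; apply.
have M0 : (M n)%:R != 0 :> R by rewrite pnatr_eq0 -lt0n (leq_trans _ kM).
have e : k.+1%:R * 'C(M n, k.+1)%:R = ((M n)%:R - k%:R) * 'C(M n, k)%:R :> R.
  by rewrite -natrM mul_bin_left natrM natrB // ltnW.
have -> : 'C(M n, k.+1)%:R = ((M n)%:R - k%:R) * 'C(M n, k)%:R / k.+1%:R :> R.
  by rewrite -e mulrAC divff ?mul1r // pnatr_eq0.
have -> : 1 - k%:R * (M n)%:R^-1 = ((M n)%:R - k%:R) / (M n)%:R :> R.
  by rewrite mulrBl divff.
by rewrite exprS invfM; ring.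
Unshelve. all: by end_near.
Qed.

Context (c : R).
Definition log_rate n : R := ln (M n)%:R + c.
Local Notation L := log_rate.
Local Notation N n := (2 * M n).+1.

Lemma log_rate_oo : L n @[n --> \oo] --> +oo.
Proof.
have /cvgryPge h : (M n)%:R @[n --> \oo] --> (+oo : set_system R) by exact/cvgrnyP.
apply/cvgryPge => A; have := h (expR (A - c)).
apply: filterS => n {}h; rewrite -lerBlDr -[leLHS]expRK ler_ln ?posrE ?expR_gt0 //.
by apply: lt_le_trans h; exact: expR_gt0.
Qed.

Lemma expR_log_rate n : (0 < M n)%N -> expR (L n) = (M n)%:R * expR c.
Proof. by move=> M0; rewrite expRD lnK // posrE ltr0n. Qed.

(** Powers of the logarithm are negligible: [L ^+ a.+1 / a.+1`!] is at most
    [expR L], which is proportional to [M]. *)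
Lemma cvg_log_rate_expn a : L n ^+ a / (N n)%:R @[n --> \oo] --> 0.
Proof.
have cV : (L n)^-1 @[n --> \oo] --> 0.
  apply/gtr0_cvgV0; last exact: log_rate_oo.
  by move/cvgryPgt : log_rate_oo; apply.
have up : (a.+1)`!%:R * expR c * (L n)^-1 @[n --> \oo] --> 0.
  exact: cvg0Ml.
apply: (squeeze_cvgr _ (cvg_cst 0) up); near=> n.
have L0 : 0 < L n by near: n; move/cvgryPgt : log_rate_oo; apply.
have M0 : (0 < M n)%N by near: n; move/cvgnyPge : M_oo; apply.
apply/andP; split; first by rewrite divr_ge0 ?exprn_ge0 ?ltW.
rewrite ler_pdivlMr // mulrAC ler_pdivrMr // -exprSr.
have := expR_ge1Dxn a (ltW L0); rewrite expR_log_rate // => h.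
have f0 : 0 < (a.+1)`!%:R :> R by rewrite ltr0n fact_gt0.
have {h} : L n ^+ a.+1 / (a.+1)`!%:R <= (M n)%:R * expR c.
  by apply: le_trans h; rewrite lerDr.
rewrite ler_pdivrMr // => h; apply: le_trans h _.
have -> : (M n)%:R * expR c * (a.+1)`!%:R = (a.+1)`!%:R * expR c * (M n)%:R by ring.
by rewrite ler_wpM2l ?mulr_ge0 ?expR_ge0 // ler_nat; lia.
Unshelve. all: by end_near.
Qed.

Lemma near_log_rate_ge (A : R) : \forall n \near \oo, A <= L n.
Proof. by move/cvgryPge : log_rate_oo; apply. Qed.

Context (d : nat) (d_ge2 : (2 <= d)%N).
Local Notation p n := (threshold d (N n) c : R).

Let fact0 : 0 < d`!%:R :> R. Proof. by rewrite ltr0n fact_gt0. Qed.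

Lemma threshold_expn n : 0 <= L n -> p n ^+ d = d`!%:R * L n / (N n)%:R ^+ d.-1.
Proof.
move=> L0; rewrite /threshold.
have -> : ((N n)%:R - 1) / 2 = (M n)%:R :> R.
  by rewrite -natr1 addrK natrM mulrAC divff ?mul1r // pnatr_eq0.
rewrite -powR_mulrn ?powR_ge0 // -powRrM mulVf ?pnatr_eq0 -?lt0n ?(ltnW d_ge2) //.
by rewrite powRr1 // divr_ge0 ?exprn_ge0 ?ler0n // mulr_ge0 // ltW.
Qed.

(** By [threshold_expn] the product is a constant times [L ^+ 2 / N ^+ d.-1]. *)
Lemma cvg_log_rate_threshold : L n * p n ^+ d @[n --> \oo] --> 0.
Proof.
have up : d`!%:R * (L n ^+ 2 / (N n)%:R) @[n --> \oo] --> 0.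
  exact: (cvg0Ml _ (cvg_log_rate_expn 2)).
apply: (squeeze_cvgr _ (cvg_cst 0) up); near=> n.
have L0 : 0 <= L n by near: n; exact: near_log_rate_ge.
rewrite mulr_ge0 ?exprn_ge0 ?powR_ge0 //= threshold_expn //.
have -> : L n * (d`!%:R * L n / (N n)%:R ^+ d.-1) = d`!%:R * (L n ^+ 2 / (N n)%:R ^+ d.-1).
  by rewrite expr2; ring.
rewrite ler_wpM2l ?(ltW fact0) // ler_wpM2l ?exprn_ge0 //.
rewrite lef_pV2 ?posrE ?exprn_gt0 ?ltr0n // ler_eXnr ?ler1n //.
by rewrite -ltnS prednK // ltnW.
Unshelve. all: by end_near.
Qed.

Lemma cvg_threshold_expn : p n ^+ d @[n --> \oo] --> 0.
Proof.
apply: (squeeze_cvgr _ (cvg_cst 0) cvg_log_rate_threshold); near=> n.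
have L1 : 1 <= L n by near: n; exact: near_log_rate_ge.
by rewrite exprn_ge0 ?powR_ge0 //= ler_peMl // exprn_ge0 ?powR_ge0.
Unshelve. all: by end_near.
Qed.

Lemma near_threshold_half : \forall n \near \oo, p n ^+ d <= 2^-1.
Proof.
have h : 0 < 2^-1 :> R by rewrite invr_gt0.
move/cvgr0Pnorm_le : cvg_threshold_expn => /(_ _ h); apply: filterS => n.
by rewrite ger0_norm // exprn_ge0 ?powR_ge0.
Qed.

Lemma near_threshold_le1 : \forall n \near \oo, p n <= 1.
Proof.
apply: filterS near_threshold_half => n pd.
rewrite -(@ler_pXn2r _ d) ?nnegrE ?powR_ge0 ?(ltnW d_ge2) // expr1n.
by apply: le_trans pd _; rewrite invf_le1 // ler1n.
Qed.

Lemma mean_degree_expn n : 0 <= L n ->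
  ((N n)%:R * p n) ^+ d = (N n)%:R * (d`!%:R * L n).
Proof.
move=> L0; rewrite exprMn threshold_expn // -{1}(prednK (ltnW d_ge2)) exprS.
have : (N n)%:R != 0 :> R by rewrite pnatr_eq0.
by move: (N n)%:R => Nr N0; field; rewrite ?expf_neq0.
Qed.

Lemma near_mean_degree_ge1 : \forall n \near \oo, 1 <= (N n)%:R * p n.
Proof.
near=> n; have L1 : 1 <= L n by near: n; exact: near_log_rate_ge.
rewrite -(@ler_pXn2r _ d) ?nnegrE ?(ltnW d_ge2) ?mulr_ge0 ?powR_ge0 // expr1n.
rewrite mean_degree_expn ?(le_trans _ L1) // -[leLHS]mulr1 ler_pM ?ler1n //.
by rewrite -[leLHS]mulr1 ler_pM // ler1n fact_gt0.
Unshelve. all: by end_near.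
Qed.

(** The [d]-th power of [L * t ^+ d.-1 / N], where [t = N * p] is of order
    [(N * L) ^ (1 / d)], is a constant times [L ^+ (2 * d).-1 / N]. *)
Lemma cvg_log_rate_short : L n * (((N n)%:R * p n) ^+ d.-1 / (N n)%:R) @[n --> \oo] --> 0.
Proof.
have h (Nr x y z : R) e : Nr != 0 -> x * (y * z / Nr) = y *
  (Nr ^+ e * (x * z) / (Nr * Nr ^+ e)).
  by move=> N0; field; rewrite N0 expf_neq0.
apply: (@cvg0_of_expn _ d) (ltnW d_ge2) _.
have := cvg0Ml (d`!%:R ^+ d.-1) (cvg_log_rate_expn (2 * d).-1).
apply: cvg_trans; apply: near_eq_cvg; near=> n.
have L0 : 0 <= L n by near: n; exact: near_log_rate_ge.
have := mean_degree_expn L0; set t := _ * p n => tE.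
rewrite 2!exprMn -[t ^+ d.-1 ^+ d]exprM [(d.-1 * d)%N]mulnC exprM tE 2!exprMn.
rewrite (_ : (2 * d).-1 = (d + d.-1)%N); last by lia.
rewrite exprVn exprD.
have -> : (N n)%:R ^+ d = (N n)%:R * (N n)%:R ^+ d.-1 :> R by rewrite -exprS prednK // ltnW.
have : (N n)%:R != 0 :> R by rewrite pnatr_eq0.
exact: h.
Unshelve. all: by end_near.
Qed.

Lemma cvg_short : ((N n)%:R * p n) ^+ d.-1 / (N n)%:R @[n --> \oo] --> 0.
Proof.
apply: (squeeze_cvgr _ (cvg_cst 0) cvg_log_rate_short); near=> n.
have L1 : 1 <= L n by near: n; exact: near_log_rate_ge.
have u0 : 0 <= ((N n)%:R * p n) ^+ d.-1 / (N n)%:R.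
  by rewrite divr_ge0 ?exprn_ge0 ?mulr_ge0 ?powR_ge0.
by rewrite u0 ler_peMl.
Unshelve. all: by end_near.
Qed.

End Asymptotics.

Section MomentLimit.
Local Open Scope classical_set_scope.
Context (R : realType) (d : nat) (d_ge2 : (2 <= d)%N) (c : R).
Context (G : nat -> finZmodType) (oddG : forall n, odd #|G n|)
  (cardG_oo : #|G n| @[n --> \oo] --> \oo).
Local Notation M n := #|{: inversion_class (G n)}|.
Local Notation N n := (2 * M n).+1.
Local Notation L := (log_rate (fun n => M n) c).
Local Notation p n := (threshold d (N n) c : R).

Lemma card_classes_oo : M n @[n --> \oo] --> \oo.
Proof.
apply/cvgnyPge => A; move/cvgnyPge : cardG_oo => /(_ (2 * A).+1).
by apply: filterS => n; rewrite card_inversion_class // ltnS leq_mul2l.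
Qed.

Lemma intensity_threshold n : 0 <= L n -> intensity (G n) d (p n) = L n.
Proof.
move=> L0; rewrite /intensity (threshold_expn d_ge2 L0) card_inversion_class //.
have f0 : d`!%:R != 0 :> R by rewrite pnatr_eq0 -lt0n fact_gt0.
have : (N n)%:R != 0 :> R by rewrite pnatr_eq0.
by move: (N n)%:R => Nr N0; field; rewrite f0 expf_neq0.
Qed.

Lemma expR_mulN_log_rate k n : (0 < M n)%N ->
  expR (- (k%:R * L n)) = expR (- c) ^+ k / (M n)%:R ^+ k.
Proof.
move=> M0; rewrite -mulrN expRM_natl (expRN (L n)) expR_log_rate // invfM exprMn mulrC.
by rewrite -expRN exprVn.
Qed.

(** In both bounds the exponential of [- (k%:R * L)] is [expR (- c) ^+ k]
    divided by [M ^+ k], which turns the number of choices of [k] classes into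
    [k`!%:R^-1] in the limit; [e1], [e2] and [e3] collect the errors. *)
Lemma cvg_moment k :
  moment (G n) d (p n) k @[n --> \oo] --> expR (- c) ^+ k / k`!%:R.
Proof.
have M_oo := card_classes_oo.
have cbin := @cvg_bin_over_expn R _ M_oo k.
pose e1 n := (k * nongeneric_bound d k)%:R * (L n / (N n)%:R) +
  (overlap_bound d k)%:R * d`!%:R * (L n * (((N n)%:R * p n) ^+ d.-1 / (N n)%:R)).
have ce1 : e1 n @[n --> \oo] --> 0.
  have h1 := @cvg_log_rate_expn R _ M_oo c 1;
    have h2 := @cvg_log_rate_short R _ M_oo c _ d_ge2.
  rewrite -[X in _ --> X]addr0; exact: (cvgD (cvg0Ml _ h1) (cvg0Ml _ h2)).
(* The excess of the exponent in the lower bound over - k * L. *)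
pose e2 n := - (2 * k%:R * (L n * p n ^+ d)).
have ce2 : e2 n @[n --> \oo] --> 0.
  rewrite -[X in _ --> X]oppr0; apply: cvgN.
  exact: (cvg0Ml _ (@cvg_log_rate_threshold R _ M_oo c _ d_ge2)).
pose e3 n := ((2 * d).+1 ^ d * d)%:R * (((N n)%:R * p n) ^+ d.-1 / (N n)%:R) * 3.
have ce3 : e3 n @[n --> \oo] --> 0.
  rewrite -[X in _ --> X](mul0r 3); apply: cvgMr_tmp.
  exact: (cvg0Ml _ (@cvg_short R _ M_oo c _ d_ge2)).
have cexp e : e n @[n --> \oo] --> 0 -> expR (e n) @[n --> \oo] --> (1 : R).
  by move=> ce; rewrite -expR0; apply: continuous_cvg => //; exact: continuous_expR.
pose up n := expR (- c) ^+ k * ('C(M n, k)%:R / (M n)%:R ^+ k * expR (e1 n)).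
pose lo n := expR (- c) ^+ k * (('C(M n, k)%:R / (M n)%:R ^+ k - e3 n) * expR (e2 n)).
have cup : up n @[n --> \oo] --> expR (- c) ^+ k / k`!%:R.
  by rewrite -[X in _ * X]mulr1; apply: cvgMl_tmp; apply: cvgM => //; exact: cexp.
have clo : lo n @[n --> \oo] --> expR (- c) ^+ k / k`!%:R.
  rewrite -[X in _ * X]subr0 -[X in _ * X]mulr1.
  by apply: cvgMl_tmp; apply: cvgM; [exact: cvgB|exact: cexp].
apply: (squeeze_cvgr _ clo cup); near=> n.
have L0 : 0 <= L n by near: n; exact: near_log_rate_ge.
have M0 : (0 < M n)%N by near: n; move/cvgnyPge : M_oo; apply.
have M0R : 0 < (M n)%:R :> R by rewrite ltr0n.
have p1 : p n <= 1 by near: n; exact: near_threshold_le1.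
have ph : p n ^+ d <= 2^-1 by near: n; exact: near_threshold_half.
have Np : 1 <= #|G n|%:R * p n.
  rewrite card_inversion_class //; near: n; exact: near_mean_degree_ge1.
have p0 : 0 <= p n by exact: powR_ge0.
apply/andP; split.
  apply: le_trans (moment_lower (oddG n) d_ge2 p0 p1 Np k ph).
  rewrite intensity_threshold // card_inversion_class //.
  rewrite (_ : - (k%:R * L n * (1 + 2 * p n ^+ d)) = - (k%:R * L n) + e2 n);
    last by rewrite /e2; ring.
  rewrite expRD.
  rewrite expR_mulN_log_rate // /lo -!mulrA ler_wpM2l ?exprn_ge0 ?expR_ge0 //.
  rewrite [leLHS]mulrC [leRHS]mulrCA.
  rewrite ler_wpM2l ?expR_ge0 // mulrBr natrX mulKf ?expf_neq0 ?gt_eqF // mulrC lerD2l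
    lerN2.
  rewrite /e3 -!mulrA ler_wpM2l ?ler0n // ler_wpM2l ?exprn_ge0 ?mulr_ge0 //.
  (* The factor 3 in e3 replaces N by M, as N = 2 * M + 1 is at most 3 * M. *)
  rewrite ler_pdivlMl ?ltr0n // ler_pdivrMr //.
  by rewrite -!natrM ler_nat; lia.
apply: le_trans (moment_upper (oddG n) d_ge2 p0 p1 Np k) _.
rewrite intensity_threshold // card_inversion_class // -addrA expRD expR_mulN_log_rate //.
rewrite /up mulrCA -!mulrA ler_wpM2l ?exprn_ge0 ?expR_ge0 // mulrCA ler_wpM2l //.
rewrite ler_wpM2l ?invr_ge0 ?exprn_ge0 // ler_expR /e1.
by rewrite le_eqVlt; apply/orP; left; apply/eqP; ring.
Unshelve. all: by end_near.
Qed.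

End MomentLimit.

(** * The Poisson limit *)

Section PoissonPmf.
Context (R : realType).

Lemma Poisson_set1 (mu : R) (k : nat) : 0 < mu ->
  fine (Poisson mu [set k]%classic) = mu ^+ k / k`!%:R * expR (- mu).
Proof.
move=> mu0; rewrite /Poisson /= /poisson_prob mu0 esum_set1 ?lee_fin ?poisson_pmf_ge0 //=.
by rewrite /poisson_pmf mu0.
Qed.

End PoissonPmf.

Local Open Scope classical_set_scope.
Local Open Scope ring_scope.

Theorem corollary1p2 (R : realType) (d : nat) (d_ge2 : (2 <= d)%N)
  (G : nat -> finZmodType) (oddG : forall n, odd #|G n|)
  (cardG_oo : #|G n| @[n --> \oo] --> \oo)
  (disp : nat -> measure_display)
  (Omega : forall n, measurableType (disp n))
  (P : forall n, probability (Omega n) R)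
  (T : forall n, inversion_class (G n) -> {RV (P n) >-> R})
  (T_unif : forall n xi, uniform01 (T n xi))
  (T_indep : forall n, mutually_independent (T n))
  (c : R) :
  let r n := threshold d #|G n| c in
  let V n := far_class_count (T n) d (r n) in
  let W n := far_vertex_count (T n) d (r n) in
  [/\ dTV (distribution (P n) (V n)) (Poisson (expR (- c)))
        @[n --> \oo] --> 0%E,
      P n [set w | (diameter R (Gamma (T n) (r n) w) <= d%:R%:E)%E]
        @[n --> \oo] --> (expR (- expR (- c)))%:E
    & forall n (w : Omega n), W n w = (2 * V n w)%N].
Proof.
move=> r V W.
have r_ge0 n : 0 <= r n by exact: powR_ge0.
have rE n : r n = threshold d (2 * #|{: inversion_class (G n)}|).+1 c.
  by rewrite /r card_inversion_class.
have M_oo := card_classes_oo oddG cardG_oo.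
have near_r_le1 : \forall n \near \oo, r n <= 1.
  by apply: filterS (@near_threshold_le1 R _ M_oo c d d_ge2) => n; rewrite rE.
have VE n w : V n w = #|far_classes d (active (T n) (r n) w)|.
  exact: far_classes_card.
pose u (j n : nat) := expect (r n)
  (fun S : {set inversion_class (G n)} => (#|far_classes d S| == j)%:R) : R.
have cu j : u j n @[n --> \oo] --> expR (- c) ^+ j / j`!%:R * expR (- expR (- c)).
  apply: (@cvg_pmf _ _ _ (fun n k => moment (G n) d (r n) k)).
    move=> k; under eq_cvg do rewrite rE; exact: cvg_moment.
  apply: filterS near_r_le1 => n r1 m; exact: expect_bonferroni.
have PV j : \forall n \near \oo, P n [set w | V n w = j] = (u j n)%:E.
  apply: filterS near_r_le1 => n r1.
  rewrite -(prob_active (T_unif n) (T_indep n) (r_ge0 n) r1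
    (fun S => #|far_classes d S| == j)).
  by congr (P n _); apply/seteqP; split=> w /=; rewrite VE => /eqP.
split.
- apply: scheffe => j; rewrite Poisson_set1 ?expR_gt0 //.
  apply: cvg_trans (cu j); apply: near_eq_cvg.
  by apply: filterS (PV j) => n PVn; rewrite /distribution /pushforward /= [X in fine X]PVn.
- have := cu 0%N; rewrite expr0 fact0 divff // mul1r => cu0.
  have : (u 0%N n)%:E @[n --> \oo] --> (expR (- expR (- c)))%:E.
    by apply: cvg_EFin => //; exact: nearW.
  apply: cvg_trans; apply: near_eq_cvg; apply: filterS (PV 0%N) => n <-.
  congr (P n _); apply/seteqP; split=> w /=.
    by rewrite VE => /(diameter_le_far R); apply.
  by rewrite VE => /(diameter_le_far R).
- move=> n w; exact: far_vertices_card.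
Qed.
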